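(* Let $M$ be a Riemannian manifold, let $Y$ be a metric space and let $P:M\to Y$ be a submetry. Then every fiber $L=P^{-1}(y)$, $y\in Y$, is a set of positive reach in $M$.
   Context: Conventions. A Riemannian manifold $M$ (not necessarily complete) is equipped with its Riemannian distance and is assumed to be sufficiently smooth; precisely, it has local two-sided curvature bounds in the sense of Alexandrov (this holds, for instance, if the Riemannian metric is $\mathcal C^{1,1}$ in some coordinates). A map $P:X\to Y$ between metric spaces is a submetry if $P(B_r(x))=B_r(P(x))$ for all $x\in X$ and all $r>0$, where $B_r$ denotes open metric balls. A subset $L\subset M$ has positive reach in $M$ if there is a neighborhood $U$ of $L$ in $M$ such that for every $x\in U$ there exists a unique point $\Pi^L(x)\in L$ (the foot point) closest to $x$ in $L$. *)

(* Defs.v *)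
From HB Require Import structures.
From mathcomp Require Import all_boot all_order all_algebra.
From mathcomp Require Import all_classical all_reals all_analysis.

Set Implicit Arguments.
Unset Strict Implicit.
Unset Printing Implicit Defensive.

Import Order.TTheory GRing.Theory Num.Theory.
Import numFieldNormedType.Exports.

Local Open Scope classical_set_scope.
Local Open Scope ring_scope.

Definition bilin (R : realType) (n : nat) (g : 'M[R]_n) (v w : 'rV[R]_n) : R :=
  (v *m g *m w^T) 0 0.

(* In finite dimension, continuity of all u |-> df_u(v) is continuity of df. *)
Definition C1_on (R : realType) (m n : nat) (A : set 'rV[R]_m)
    (f : 'rV[R]_m -> 'rV[R]_n) : Prop :=
  (forall u, A u -> differentiable f u) /\
  (forall v, {within A, continuous (fun u => 'd f u v)}).

(* A C^1 curve on a compact interval (one-sided derivatives at the endpoints)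
   is the restriction of such a curve defined on all of R. *)
Definition C1_curve (R : realType) (n : nat) (c : R -> 'rV[R]_n) : Prop :=
  (forall t, derivable c t 1) /\ continuous (derive1 c).

(* Manifold without boundary of dimension n, with a C^1 atlas and a continuous
   Riemannian metric: the least regularity for which lengths of C^1 curves make
   sense.  In the chart i the metric at the point of coordinates u is the
   bilinear form of the matrix rmetric i u. *)
Record riemannian_structure (R : realType) (n : nat) (M : topologicalType) :=
  RiemannianStructure {
  index : Type ;
  dom : index -> set M ;
  chart : index -> M -> 'rV[R]_n ;
  param : index -> 'rV[R]_n -> M ;
  rmetric : index -> 'rV[R]_n -> 'M[R]_n ;
  dom_open : forall i, open (dom i) ;
  dom_cover : forall x, exists i, dom i x ;
  chart_open : forall i, open (chart i @` dom i) ;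
  chartK : forall i x, dom i x -> param i (chart i x) = x ;
  chart_continuous : forall i, {within dom i, continuous (chart i)} ;
  param_continuous : forall i,
    {within chart i @` dom i, continuous (param i)} ;
  transition_C1 : forall i j,
    C1_on (chart i @` (dom i `&` dom j)) (chart j \o param i) ;
  rmetric_sym : forall i u, (chart i @` dom i) u ->
    (rmetric i u)^T = rmetric i u ;
  rmetric_pos : forall i u v, (chart i @` dom i) u -> v != 0 ->
    0 < bilin (rmetric i u) v v ;
  rmetric_continuous : forall i,
    {within chart i @` dom i, continuous (rmetric i)} ;
  rmetric_transition : forall i j u v w,
    (chart i @` (dom i `&` dom j)) u ->
    let tau := chart j \o param i in
    bilin (rmetric i u) v w =
    bilin (rmetric j (tau u)) ('d tau u v) ('d tau u w) }.

(* Length of a C^1 curve, parametrized by [0, 1], in the chart i. *)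
Definition chart_length (R : realType) (n : nat) (M : topologicalType)
    (S : riemannian_structure R n M) (i : index S) (c : R -> 'rV[R]_n) : R :=
  \int[lebesgue_measure]_(t in `[0, 1])
    Num.sqrt (bilin (rmetric i (c t)) (derive1 c t) (derive1 c t)).

(* curve_length S x y l: some piecewise C^1 curve from x to y has length l.  By
   compactness, such a curve is a finite concatenation of C^1 pieces each lying
   in a single chart. *)
Inductive curve_length (R : realType) (n : nat) (M : topologicalType)
    (S : riemannian_structure R n M) : M -> M -> R -> Prop :=
| curve_length_nil x : curve_length S x x 0
| curve_length_cons (i : index S) (c : R -> 'rV[R]_n) y l :
    C1_curve c ->
    (forall t, 0 <= t <= 1 -> (chart i @` dom i) (c t)) ->
    curve_length S (param i (c 1)) y l ->
    curve_length S (param i (c 0)) y (chart_length i c + l).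

(* The nonemptiness clause says that M is connected. *)
Definition is_riemannian_distance (R : realType) (n : nat) (M : metricType R)
    (S : riemannian_structure R n M) : Prop :=
  forall x y : M, [set l | curve_length S x y l] !=set0 /\
    mdist x y = inf [set l | curve_length S x y l].

Definition arcosh (R : realType) (x : R) : R :=
  ln (x + Num.sqrt (x ^+ 2 - 1)).

(* The simply connected surface of constant curvature k.  In the coordinates
   (p.1, sqrt `|k| *: p.2) this is the unit sphere of R^3 if 0 < k, and the upper
   sheet of the unit hyperboloid if k < 0; if k = 0 it is the plane p.1 = 1. *)
Definition model_form (R : realType) (k : R) (p q : R * 'rV[R]_2) : R :=
  p.1 * q.1 + k * bilin 1%:M p.2 q.2.

Definition model_plane (R : realType) (k : R) : set (R * 'rV[R]_2) :=
  [set p | model_form k p p = 1 /\ (k <= 0 -> 0 < p.1)].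

Definition model_dist (R : realType) (k : R) (p q : R * 'rV[R]_2) : R :=
  if 0 < k then acos (model_form k p q) / Num.sqrt k
  else if k < 0 then arcosh (model_form k p q) / Num.sqrt (- k)
  else Num.sqrt (bilin 1%:M (p.2 - q.2) (p.2 - q.2)).

(* Shortest path from x to y in U, parametrized by [0, 1] proportionally to
   arc length. *)
Definition geodesic (R : realType) (M : metricType R) (U : set M) (x y : M)
    (f : R -> M) : Prop :=
  [/\ f 0 = x, f 1 = y,
      (forall t, 0 <= t <= 1 -> U (f t)) &
      (forall s t, 0 <= s <= 1 -> 0 <= t <= 1 ->
        mdist (f s) (f t) = `|s - t| * mdist x y)].

(* triangle_comparison k U cmp: for every geodesic triangle abc contained in U
   and every point d of the side bc, cmp |ad| |a'd'| holds for the comparison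
   triangle a'b'c' in the model plane of curvature k and the point d' of b'c'
   corresponding to d.  As Num.sqrt k = 0 for k <= 0, the bound on the perimeter,
   namely 2 pi / sqrt k, only matters if 0 < k. *)
Definition triangle_comparison (R : realType) (M : metricType R) (k : R)
    (U : set M) (cmp : R -> R -> Prop) : Prop :=
  forall (a b c : M) (fab fbc fca : R -> M),
  geodesic U a b fab -> geodesic U b c fbc -> geodesic U c a fca ->
  (mdist a b + mdist b c + mdist c a) * Num.sqrt k < 2 * pi ->
  forall a' b' c' d' : R * 'rV[R]_2,
  model_plane k a' -> model_plane k b' -> model_plane k c' ->
  model_plane k d' ->
  model_dist k a' b' = mdist a b -> model_dist k b' c' = mdist b c ->
  model_dist k c' a' = mdist c a ->
  forall t : R, 0 <= t <= 1 ->
  model_dist k b' d' = mdist b (fbc t) ->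
  model_dist k d' c' = mdist (fbc t) c ->
  cmp (mdist a (fbc t)) (model_dist k a' d').

Definition curvature_ge (R : realType) (M : metricType R) (k : R) (U : set M) :=
  triangle_comparison k U (fun d d' => d' <= d).

Definition curvature_le (R : realType) (M : metricType R) (k : R) (U : set M) :=
  triangle_comparison k U (fun d d' => d <= d').

Definition local_two_sided_curvature_bounds (R : realType) (M : metricType R) :
    Prop :=
  forall x : M, exists (U : set M) (k K : R),
    [/\ open U, U x, curvature_ge k U & curvature_le K U].

Definition submetry (R : realType) (X Y : metricType R) (P : X -> Y) : Prop :=
  forall (x : X) (r : R), 0 < r -> P @` ball x r = ball (P x) r.

Definition foot_point (R : realType) (M : metricType R) (L : set M)
    (x p : M) : Prop :=
  L p /\ (forall q, L q -> mdist x p <= mdist x q).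

Definition positive_reach (R : realType) (M : metricType R) (L : set M) : Prop :=
  exists U : set M, [/\ open U, L `<=` U &
    forall x, U x -> exists! p, foot_point L x p].

(* Main.v *)
Require Import Defs.
From mathcomp Require Import all_boot all_order all_algebra.
From mathcomp Require Import all_classical all_reals all_analysis.
From mathcomp Require Import ring lra.

Set Implicit Arguments.
Unset Strict Implicit.
Unset Printing Implicit Defensive.

Import Order.TTheory GRing.Theory Num.Theory.
Import numFieldNormedType.Exports.

Local Open Scope classical_set_scope.
Local Open Scope ring_scope.

(** Why fibers of submetries have positive reach.

    Let L be the fiber through p.  A submetry is 1-Lipschitz and lifts points:
    if P u is at distance d from z, then z has a preimage at distance d from u
    (submetry_lift).  Hence the distance to a fiber is the distance in Y to its
    image, and near p foot points exist.  Uniqueness of foot points rests on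
    the fact that L is almost convex: if m is the midpoint of a geodesic
    between two points a, b of L near p, then d (P m, P p) <= C |ab|^2
    (fiber_almost_convex).  Given this, suppose that x at distance sg from L
    has two foot points a, b.  The upper curvature bound for the isosceles
    triangle x a b gives |xm| <= sg - c |ab|^2 / sg, whereas |xm| is at least
    sg - C |ab|^2 because L comes that close to m.  So sg is bounded below
    (unique_foot_point).

    Almost convexity comes from the lower curvature bound.  Let w be a point of
    Y at a definite distance from P p.  The distance to the fiber of w is
    d (w, P _); it takes the same value at a and b, and by comparison it can
    drop at m only by a multiple of |ab|^2.  Therefore d (P m, P p) is at most
    of this order as soon as some w satisfies
    d (w, P m) <= d (w, P p) - d (P m, P p) / 2.
    The points w have to come from one finite set, as the constant depends on
    d (w, P p).  Such a set exists (finite_directions): otherwise there are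
    arbitrarily many points z_1, z_2, ..., rapidly approaching P p, for which
    the geodesics from p to suitable lifts make pairwise angles bounded below.
    By angle monotonicity under the lower curvature bound (shrink_mdist), the
    points of these geodesics at a common small distance rho from p are
    rho/8-separated, and a ball of radius rho contains only a bounded number
    of such points (packing_bound).

    Manifold charts enter in two places only: they give local compactness, whence
    geodesics between close points (geodesic_exists), and, being bi-Lipschitz
    near p (local_chart), they give the packing bound.

    All comparison estimates are phrased with chord2 k d, which is
    2 (1 - cos (sqrt k d)) / k and its analytic continuation to k <= 0.  This
    modified squared distance turns the law of cosines in the surface of
    curvature k into one polynomial identity for all k (cosine_law), and it
    is comparable to d^2 for small d. *)

(** * Trigonometry of constant curvature *)

Section ModelFunctions.
Variables (R : realType) (k : R).
Implicit Types x y : R.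

(** The solution of f'' = - k f with f(0) = 0 and f'(0) = 1; its derivative is
    [cs]. *)
Definition sn x : R :=
  if 0 < k then sin (Num.sqrt k * x) / Num.sqrt k
  else if k < 0 then
    (expR (Num.sqrt (- k) * x) - expR (- (Num.sqrt (- k) * x))) /
      (2 * Num.sqrt (- k))
  else x.

Definition cs x : R :=
  if 0 < k then cos (Num.sqrt k * x)
  else if k < 0 then
    (expR (Num.sqrt (- k) * x) + expR (- (Num.sqrt (- k) * x))) / 2
  else 1.

(** Putting k in the form w^2, - w^2 or 0 lets each trigonometric identity be
    settled by a field computation. *)
Lemma model_cases :
  [\/ exists2 w : R, 0 < w & k = w ^+ 2 /\ 0 < k /\ Num.sqrt k = w,
      exists2 w : R, 0 < w & k = - w ^+ 2 /\ (k < 0) /\ (0 < k) = false /\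
         Num.sqrt (- k) = w |
      k = 0].
Proof.
have [k0|k0|->] := ltgtP 0 k; last by constructor 3.
  constructor 1; exists (Num.sqrt k); first by rewrite sqrtr_gt0.
  by rewrite sqr_sqrtr// ltW.
constructor 2; exists (Num.sqrt (- k)); first by rewrite sqrtr_gt0 oppr_gt0.
by rewrite sqr_sqrtr ?opprK// oppr_ge0 ltW.
Qed.

Lemma snB x y : sn (x - y) = sn x * cs y - cs x * sn y.
Proof.
rewrite /sn /cs; have [[w w0 [-> [k0 wE]]]|[w w0 [kE [k0 [k0' wE]]]]|->] := model_cases.
- rewrite k0 wE mulrBr sinB; field; lra.
- rewrite k0' k0 wE mulrBr opprB !expRD; field; lra.
- by rewrite ltxx; ring.
Qed.

Lemma csB x y : cs (x - y) = cs x * cs y + k * (sn x * sn y).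
Proof.
rewrite /sn /cs; have [[w w0 [-> [k0 wE]]]|[w w0 [kE [k0 [k0' wE]]]]|->] := model_cases.
- rewrite k0 wE mulrBr cosB; field; lra.
- rewrite k0' k0 wE mulrBr opprB !expRD kE; field; lra.
- by rewrite ltxx; ring.
Qed.

Lemma sn0 : sn 0 = 0.
Proof. by rewrite /sn !mulr0 oppr0 sin0 expR0 subrr !mul0r; case: ifP => // _; case: ifP. Qed.

Lemma cs0 : cs 0 = 1.
Proof.
rewrite /cs !mulr0 oppr0 cos0 expR0; case: ifP => // _; case: ifP => // _.
by field.
Qed.

Lemma snN x : sn (- x) = - sn x.
Proof. by rewrite -{1}(sub0r x) snB sn0 cs0; ring. Qed.

Lemma csN x : cs (- x) = cs x.
Proof. by rewrite -{1}(sub0r x) csB sn0 cs0; ring. Qed.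

Lemma snD x y : sn (x + y) = sn x * cs y + cs x * sn y.
Proof. by rewrite -{1}(opprK y) snB csN snN; ring. Qed.

Lemma csD x y : cs (x + y) = cs x * cs y - k * (sn x * sn y).
Proof. by rewrite -{1}(opprK y) csB csN snN; ring. Qed.

Lemma cs2Dsn2 x : cs x ^+ 2 + k * sn x ^+ 2 = 1.
Proof. by rewrite -cs0 -(subrr x) csB !expr2. Qed.

(** This is 2 (1 - cs x) / k for k <> 0, and x^2 for k = 0; in the model surface
    of curvature k, it is the square of the chord subtending an arc of length
    x. *)
Definition chord2 x := 4 * sn (x / 2) ^+ 2.

Lemma cs_chord2 x : cs x = 1 - k / 2 * chord2 x.
Proof.
have h := cs2Dsn2 (x / 2); rewrite /chord2 [in LHS](splitr x) csD.
have -> : cs (x / 2) * cs (x / 2) = 1 - k * sn (x / 2) ^+ 2 by lra.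
by field.
Qed.

Lemma sn2_chord2 x : sn x ^+ 2 = chord2 x - k / 4 * chord2 x ^+ 2.
Proof.
have h := cs2Dsn2 (x / 2); rewrite /chord2 [in LHS](splitr x) snD.
transitivity (4 * sn (x / 2) ^+ 2 * cs (x / 2) ^+ 2); first by ring.
have -> : cs (x / 2) ^+ 2 = 1 - k * sn (x / 2) ^+ 2 by lra.
by field.
Qed.

Lemma chord2_0 : chord2 0 = 0.
Proof. by rewrite /chord2 mul0r sn0; ring. Qed.

Lemma chord2N x : chord2 (- x) = chord2 x.
Proof. by rewrite /chord2 mulNr snN sqrrN. Qed.

(** The law of cosines: in the model surface, a triangle with sides a, b and
    cosine t of the angle between them has a third side c with
    [chord2 c = cosine_law a b t]. *)
Definition cosine_law a b t :=
  chord2 a + chord2 b - k / 2 * (chord2 a * chord2 b) - 2 * (sn a * sn b) * t.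

Lemma cosine_lawB a b : cosine_law a b 1 = chord2 (a - b).
Proof.
rewrite /cosine_law /chord2 mulrBl snB [X in sn X * sn b](splitr a) [X in _ * sn X](splitr b) !snD.
have hx := cs2Dsn2 (a / 2); have hy := cs2Dsn2 (b / 2).
set x := sn (a / 2) in hx *; set x' := cs (a / 2) in hx *.
set y := sn (b / 2) in hy *; set y' := cs (b / 2) in hy *.
transitivity (4 * (x ^+ 2 * (1 - k * y ^+ 2) + (1 - k * x ^+ 2) * y ^+ 2) -
   8 * (x * x' * y * y')); first by field.
have -> : 1 - k * y ^+ 2 = y' ^+ 2 by lra.
have -> : 1 - k * x ^+ 2 = x' ^+ 2 by lra.
ring.
Qed.

Lemma cosine_lawN a b t : cosine_law a (- b) t = cosine_law a b (- t).
Proof. by rewrite /cosine_law chord2N snN; ring. Qed.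

Lemma cosine_lawD a b : cosine_law a b (-1) = chord2 (a + b).
Proof. by rewrite -cosine_lawN cosine_lawB opprK. Qed.

Lemma cosine_lawC a b t : cosine_law a b t = cosine_law b a t.
Proof. by rewrite /cosine_law; ring. Qed.

Lemma cosine_law_diag a t : cosine_law a a t = 2 * sn a ^+ 2 * (1 - t).
Proof.
rewrite /cosine_law.
transitivity (2 * (chord2 a - k / 4 * chord2 a ^+ 2) - 2 * sn a ^+ 2 * t).
  by field.
by rewrite -sn2_chord2; ring.
Qed.

(** Apollonius' formula: for l half of a side, [cosine_law a l t] measures
    the median to that side. *)
Lemma cosine_law_mid a l t : cs l * cosine_law a l t =
  (chord2 a + cosine_law a (2 * l) t) / 2 - chord2 l.
Proof.
have h1 : cs l = 1 - k / 2 * chord2 l := cs_chord2 l.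
have h2 := sn2_chord2 l.
have h3 : chord2 (2 * l) = 4 * chord2 l - k * chord2 l ^+ 2.
  rewrite {1}/chord2 (mulrC 2) mulfK ?pnatr_eq0// h2; by field.
rewrite /cosine_law h3 (_ : sn (2 * l) = 2 * (sn l * cs l)); last first.
  by rewrite (_ : 2 * l = l + l) ?snD; ring.
by rewrite h1; field.
Qed.

(** Apollonius' inequality for h at least the median of the model triangle with
    sides a, b, 2 l.  In the flat case it reads (a^2 + b^2) / 2 - h^2 <= l^2;
    curvature only inserts the factor [cs h]. *)
Lemma median_ge a b l t h : 0 <= cs l -> chord2 b = cosine_law a (2 * l) t ->
  cosine_law a l t <= chord2 h ->
  (chord2 a + chord2 b) / 2 - chord2 h <= chord2 l * cs h.
Proof.
move=> cl -> /(ler_wpM2l cl); rewrite cosine_law_mid !cs_chord2.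
by move: (cosine_law a (2 * l) t) => c; lra.
Qed.

Lemma median_le a b l t h : 0 <= cs l -> chord2 b = cosine_law a (2 * l) t ->
  chord2 h <= cosine_law a l t ->
  chord2 l * cs h <= (chord2 a + chord2 b) / 2 - chord2 h.
Proof.
move=> cl -> /(ler_wpM2l cl); rewrite cosine_law_mid !cs_chord2.
by move: (cosine_law a (2 * l) t) => c; lra.
Qed.

Lemma chord2_sub x y :
  chord2 y - chord2 x = 4 * (sn ((y + x) / 2) * sn ((y - x) / 2)).
Proof.
rewrite /chord2 !mulrDl mulNr snD snB.
have hx := cs2Dsn2 (x / 2); have hy := cs2Dsn2 (y / 2).
set a := sn (x / 2) in hx *; set a' := cs (x / 2) in hx *.
set b := sn (y / 2) in hy *; set b' := cs (y / 2) in hy *.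
transitivity (4 * (b ^+ 2 * (a' ^+ 2 + k * a ^+ 2) -
   (b' ^+ 2 + k * b ^+ 2) * a ^+ 2)); last by ring.
by rewrite hx hy; ring.
Qed.

Lemma is_derive_sn x : is_derive x 1 sn (cs x).
Proof.
rewrite /sn /cs; have [[w w0 [-> [k0 wE]]]|[w w0 [kE [k0 [k0' wE]]]]|->] := model_cases.
- rewrite k0 wE.
  apply: is_derive_eq; rewrite /GRing.scale/=; field; lra.
- rewrite k0' k0 wE.
  apply: is_derive_eq; rewrite /GRing.scale/=; field; lra.
- by rewrite ltxx; apply: is_derive_id.
Qed.

Lemma continuous_sn : continuous sn.
Proof.
move=> x; apply/differentiable_continuous/derivable1_diffP.
by have [] := is_derive_sn x.
Qed.

Lemma continuous_chord2 : continuous chord2.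
Proof.
move=> x; rewrite /chord2; apply: cvgM; first exact: cvg_cst.
by apply: cvgM; apply: (@continuous_comp _ _ _ (fun x => x / 2)) => //;
 try (by apply: cvgM; [exact: cvg_id|exact: cvg_cst]); exact: continuous_sn.
Qed.

(** The constants 3/4 and 4/3 only need to have squares between 1/2 and 2, see
    [chord2_sub_bound]. *)
Lemma sn_near0 : exists2 r : R, 0 < r &
  forall x, 0 <= x <= r -> 3 / 4 * x <= sn x <= 4 / 3 * x.
Proof.
(* The difference quotient of sn at 0 tends to 1. *)
have [h1 h2] := is_derive_sn 0.
have : h^-1 *: ((sn \o shift 0) (h *: 1) - sn 0) @[h --> 0^'] --> (1 : R).
  by rewrite -[X in _ --> X]cs0 -h2; exact: h1.
move=> /cvgrPdist_le /(_ (1/4)) /(_ ltac:(lra)) /nbhs_ballP[e /= e0 he].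
exists (e / 2); first by rewrite divr_gt0.
move=> x /andP[x0 xr].
have [->|xn0] := eqVneq x 0; first by rewrite sn0; lra.
have xp : 0 < x by rewrite lt_neqAle eq_sym xn0.
have /he : ball (0 : R) e x.
  by rewrite /ball/= sub0r normrN ger0_norm//; lra.
move=> /(_ xn0) /=; rewrite sn0 subr0 addr0 /GRing.scale/= mulr1.
rewrite ler_norml => /andP[]; rewrite -(ler_pM2l xp) mulrBr mulrA divff// mul1r.
move=> h3; rewrite -(ler_pM2l xp) mulrBr mulrA divff// mul1r => h4.
by lra.
Qed.

End ModelFunctions.

(** * Comparison triangles *)

Section ModelPlane.
Variables (R : realType) (k : R).
Implicit Types x y : R.

(** Below this radius the model surface is uniformly close to the Euclidean
    plane; for k > 0, the radius is at most half of a great circle. *)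
Definition model_radius (r : R) : Prop :=
  [/\ 0 < r, Num.sqrt k * r <= pi &
    forall x, 0 <= x <= r -> 3 / 4 * x <= sn k x <= 4 / 3 * x].

Lemma model_radius_exists : exists r, model_radius r.
Proof.
have [r r0 hr] := sn_near0 k.
have w0 : 0 <= Num.sqrt k by exact: sqrtr_ge0.
have pi0 := pi_gt0 R.
have w1 : 0 < 1 + Num.sqrt k by lra.
exists (Num.min r (pi / (1 + Num.sqrt k))); split.
- by rewrite lt_min r0 divr_gt0.
- have : Num.min r (pi / (1 + Num.sqrt k)) <= pi / (1 + Num.sqrt k).
    by rewrite ge_min lexx orbT.
  rewrite ler_pdivlMr//; set m := Num.min _ _.
  have : 0 < m by rewrite lt_min r0 divr_gt0.
  lra.
- move=> x /andP[x0]; rewrite le_min => /andP[xr _]; apply: hr.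
  by rewrite x0.
Qed.

Lemma model_radiusW r s : model_radius r -> 0 < s -> s <= r -> model_radius s.
Proof.
move=> [r0 hr1 hr2] s0 sr; split => //.
  by apply: le_trans hr1; rewrite ler_wpM2l// sqrtr_ge0.
by move=> x /andP[x0 xs]; apply: hr2; rewrite x0 (le_trans xs).
Qed.

Lemma sn_ge0 r x : model_radius r -> 0 <= x <= r -> 0 <= sn k x.
Proof. by move=> [_ _ hr] /[dup] /andP[x0 _] /hr; lra. Qed.

Lemma sn_gt0 r x : model_radius r -> 0 < x <= r -> 0 < sn k x.
Proof.
move=> [_ _ hr] /andP[x0 xr].
by have /hr : 0 <= x <= r; [rewrite ltW|lra].
Qed.

(** The difference factors as 4 sn ((y + x) / 2) sn ((y - x) / 2), just as
    y^2 - x^2 does. *)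
Lemma chord2_sub_bound r x y : model_radius r -> 0 <= x -> x <= y -> y <= r ->
  (y ^+ 2 - x ^+ 2) / 2 <= chord2 k y - chord2 k x <= 2 * (y ^+ 2 - x ^+ 2).
Proof.
move=> [r0 _ hr] x0 xy yr; rewrite chord2_sub.
have /hr /andP[p1 p2] : 0 <= (y + x) / 2 <= r by lra.
have /hr /andP[q1 q2] : 0 <= (y - x) / 2 <= r by lra.
set p := sn _ _ in p1 p2 *; set q := sn _ _ in q1 q2 *.
have -> : y ^+ 2 - x ^+ 2 = 4 * ((y + x) / 2 * ((y - x) / 2)) by field.
have u0 : 0 <= (y + x) / 2 by lra.
have v0 : 0 <= (y - x) / 2 by lra.
move: u0 v0 p1 p2 q1 q2; set u := (y + x) / 2; set v := (y - x) / 2.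
move=> u0 v0 p1 p2 q1 q2.
have uv0 : 0 <= u * v by exact: mulr_ge0.
have h1 : (3 / 4 * u) * (3 / 4 * v) <= p * q by apply: ler_pM => //; lra.
have h2 : p * q <= (4 / 3 * u) * (4 / 3 * v) by apply: ler_pM => //; lra.
by apply/andP; split; lra.
Qed.

Lemma chord2_bound r x : model_radius r -> 0 <= x -> x <= r ->
  x ^+ 2 / 2 <= chord2 k x <= 2 * x ^+ 2.
Proof.
move=> hr x0 xr; have := chord2_sub_bound hr (lexx 0) x0 xr.
by rewrite chord2_0 expr0n/= !subr0.
Qed.

Lemma chord2_le r x y : model_radius r -> 0 <= x -> x <= y -> y <= r ->
  chord2 k x <= chord2 k y.
Proof.
move=> hr x0 xy yr; have /andP[h _] := chord2_sub_bound hr x0 xy yr.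
rewrite -subr_ge0; apply: le_trans h.
by rewrite divr_ge0// subr_ge0 ler_pXn2r// nnegrE// (le_trans x0).
Qed.

Lemma chord2_ge0 x : 0 <= chord2 k x.
Proof. by apply: mulr_ge0 => //; exact: sqr_ge0. Qed.

Lemma chord2_cs_le r s l h : model_radius r -> 0 <= h -> h <= s -> s <= r ->
  0 <= l -> l <= r -> chord2 k l * cs k h <= 2 * l ^+ 2 * (1 + `|k| * s ^+ 2).
Proof.
move=> hr h0 hs sr l0 lr.
have /andP[_ vl] := chord2_bound hr l0 lr.
have /andP[_ vh] := chord2_bound hr h0 (le_trans hs sr).
have h2 : h ^+ 2 <= s ^+ 2 by apply: lerXn2r; rewrite ?nnegrE// (le_trans h0).
have B0 : 0 <= 1 + `|k| * s ^+ 2 by rewrite addr_ge0// mulr_ge0// sqr_ge0.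
apply: (@le_trans _ _ (chord2 k l * (1 + `|k| * s ^+ 2))); last first.
  exact: ler_wpM2r.
apply: ler_wpM2l; first exact: chord2_ge0.
rewrite cs_chord2.
have k1 : - k * chord2 k h <= `|k| * chord2 k h.
  by apply: ler_wpM2r; [exact: chord2_ge0|rewrite -normrN ler_norm].
have k2 : `|k| * chord2 k h <= `|k| * (2 * s ^+ 2).
  by apply: ler_wpM2l => //; lra.
by lra.
Qed.

Lemma chord2_cs_ge r l h : model_radius r -> 0 <= h -> h <= r ->
  0 <= l -> l <= r -> 2 * `|k| * h ^+ 2 <= 1 ->
  l ^+ 2 / 4 <= chord2 k l * cs k h.
Proof.
move=> hr h0 hr' l0 lr small.
have /andP[vl _] := chord2_bound hr l0 lr.
have /andP[_ vh] := chord2_bound hr h0 hr'.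
have k1 : k * chord2 k h <= `|k| * chord2 k h.
  by apply: ler_wpM2r; [exact: chord2_ge0|exact: ler_norm].
have k2 : `|k| * chord2 k h <= `|k| * (2 * h ^+ 2) by exact: ler_wpM2l.
have c2 : 1 / 2 <= cs k h by rewrite cs_chord2; lra.
have -> : l ^+ 2 / 4 = (l ^+ 2 / 2) * (1 / 2) by field.
by apply: ler_pM => //; rewrite divr_ge0// sqr_ge0.
Qed.

(** If both sides are at least W, the median is shorter than W by O(l^2) only;
    the constant depends on the lower bound D of W. *)
Lemma median_drop r s W h l t D : model_radius r -> s <= r -> W <= s ->
  0 < D -> D <= W -> 0 <= h -> 0 <= t -> h <= W - t / 2 -> 0 <= l -> l <= r ->
  chord2 k W - chord2 k h <= chord2 k l * cs k h ->
  t <= 2 * (1 + `|k| * s ^+ 2) / D * (2 * l) ^+ 2.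
Proof.
move=> hr sr Ws D0 DW h0 t0 ht l0 lr main.
have hW : h <= W by lra.
have /andP[v1 _] := chord2_sub_bound hr h0 hW (le_trans Ws sr).
have up := chord2_cs_le hr h0 (le_trans hW Ws) sr l0 lr.
have : (t / 2) * D <= (W - h) * (W + h) by apply: ler_pM; lra.
move: up; set E := 1 + _ => up low.
have -> : 2 * E / D * (2 * l) ^+ 2 = (4 * (2 * l ^+ 2 * E)) / D.
  by field; rewrite gt_eqF.
by rewrite ler_pdivlMr//; lra.
Qed.

(** The median of an isosceles triangle with legs sg is shorter than sg by at
    least l^2 / (16 sg), which exceeds C (2 l)^2 when sg is small
    compared with 1 / C. *)
Lemma median_gap r sg h l C : model_radius r -> sg <= r -> h <= r ->
  0 < sg -> 0 <= h -> 0 < l -> l <= r -> 0 < C -> sg * (64 * C) < 1 ->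
  2 * `|k| * h ^+ 2 <= 1 -> sg <= h + C * (2 * l) ^+ 2 ->
  ~ chord2 k l * cs k h <= chord2 k sg - chord2 k h.
Proof.
move=> hr sgr hr' sg0 h0 l0 lr C0 sgC small gap main.
have low := chord2_cs_ge hr h0 hr' (ltW l0) lr small.
have l2 : 0 < l ^+ 2 by exact: exprn_gt0.
have [sgh|hsg] := leP sg h.
  by have := chord2_le hr (ltW sg0) sgh hr'; lra.
have /andP[_ up] := chord2_sub_bound hr h0 (ltW hsg) sgr.
have : (sg - h) * (sg + h) <= (C * (2 * l) ^+ 2) * (2 * sg).
  by apply: ler_pM; lra.
have : sg * (64 * C) * l ^+ 2 < 1 * l ^+ 2 by rewrite ltr_pM2r.
by lra.
Qed.

(** The point at polar coordinates (a, angle of cosine t and sine u). *)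
Definition polar (a t u : R) : R * 'rV[R]_2 :=
  (cs k a, \row_j (sn k a * if j == 0 then t else u)).

Lemma bilin1_row2 (p q : 'rV[R]_2) :
  bilin 1%:M p q = p 0 0 * q 0 0 + p 0 1 * q 0 1.
Proof.
rewrite /bilin mulmx1 mxE big_ord_recl big_ord1 !mxE.
by congr (_ * _ + p 0 _ * q 0 _); exact/val_inj.
Qed.

Lemma model_form_polar a t u e t' u' :
  model_form k (polar a t u) (polar e t' u') =
  cs k a * cs k e + k * (sn k a * sn k e * (t * t' + u * u')).
Proof. by rewrite /model_form bilin1_row2/= !mxE/=; ring. Qed.

Lemma cs_gt0 a : k <= 0 -> 0 < cs k a.
Proof.
move=> k0; rewrite /cs (le_gtF k0); case: ifP => // _.
by rewrite divr_gt0// addr_gt0// expR_gt0.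
Qed.

(** For k > 0 this uses that x is at most a quarter of a great circle. *)
Lemma cs_ge0 r x : model_radius r -> 0 <= x <= r / 2 ->
  0 <= cs k x.
Proof.
move=> [r0 hr _] /andP[x0 xr]; rewrite /cs; case: ifP => [k0|_].
  have w0 := sqrtr_ge0 k; apply: cos_ge0_pihalf.
  have : Num.sqrt k * x <= Num.sqrt k * (r / 2) by rewrite ler_wpM2l.
  have := mulr_ge0 w0 x0; have := pi_gt0 R.
  by move=> h1 h2 h3; apply/andP; split; lra.
case: ifP => // _; rewrite divr_ge0// addr_ge0// expR_ge0.
Qed.

Lemma polar_model_plane a t u : t ^+ 2 + u ^+ 2 = 1 ->
  model_plane k (polar a t u).
Proof.
move=> tu; split; last by move=> k0; exact: cs_gt0.
rewrite model_form_polar -!expr2 tu mulr1; exact: cs2Dsn2.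
Qed.

Lemma model_dist_sym (p q : R * 'rV[R]_2) : model_dist k p q = model_dist k q p.
Proof.
rewrite /model_dist /model_form !bilin1_row2.
rewrite !mxE ![q.1 * _]mulrC ![q.2 0 _ * _]mulrC.
case: ifP => // _; case: ifP => // _; congr Num.sqrt; ring.
Qed.

(** Here [cs k] is the hyperbolic cosine up to scaling, and the square root in
    [arcosh] is the hyperbolic sine. *)
Lemma arcosh_cs x : k < 0 -> 0 <= x -> arcosh (cs k x) = Num.sqrt (- k) * x.
Proof.
move=> k0 x0; rewrite /arcosh /cs (lt_gtF k0) k0.
set z := Num.sqrt (- k) * x.
have z0 : 0 <= z by rewrite mulr_ge0// sqrtr_ge0.
have -> : ((expR z + expR (- z)) / 2) ^+ 2 - 1 = ((expR z - expR (- z)) / 2) ^+ 2.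
  have : expR z * expR (- z) = 1 by rewrite -expRD subrr expR0.
  lra.
rewrite sqrtr_sqr ger0_norm; last first.
  by rewrite divr_ge0// subr_ge0 ler_expR; lra.
have -> : (expR z + expR (- z)) / 2 + (expR z - expR (- z)) / 2 = expR z.
  by field.
exact: expRK.
Qed.

(** For k <> 0 the value of [model_form] is [cs d], by the law of cosines; for
    k = 0 the law of cosines itself gives the Euclidean distance. *)
Lemma model_dist_polar r a e t u d : model_radius r ->
  t ^+ 2 + u ^+ 2 = 1 -> 0 <= d <= r -> chord2 k d = cosine_law k a e t ->
  model_dist k (polar a t u) (polar e 1 0) = d.
Proof.
move=> [r0 hr1 hr2] tu /andP[d0 dr] hd.
have hf : k != 0 -> model_form k (polar a t u) (polar e 1 0) = cs k d.
  rewrite model_form_polar (cs_chord2 k d) hd /cosine_law !cs_chord2.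
  by move=> kn0; field.
rewrite /model_dist; case: ifP => [k0|k0].
  have w0 : 0 < Num.sqrt k by rewrite sqrtr_gt0.
  rewrite hf; last by rewrite gt_eqF.
  rewrite /cs k0 cosK; first by rewrite mulrC mulKf// gt_eqF.
  rewrite in_itv/= (mulr_ge0 (ltW w0) d0)/=; apply: le_trans hr1.
  by rewrite ler_wpM2l// ltW.
case: ifP => [k0'|k0'].
  have w0 : 0 < Num.sqrt (- k) by rewrite sqrtr_gt0 oppr_gt0.
  rewrite hf; last by rewrite lt_eqF.
  by rewrite arcosh_cs// mulrC mulKf// gt_eqF.
have kE : k = 0.
  by apply/eqP; move: k0 k0'; rewrite !ltNge => /negbFE h1 /negbFE h2; lra.
rewrite -[RHS]ger0_norm// -sqrtr_sqr; congr Num.sqrt.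
move: hd; rewrite bilin1_row2 !mxE/= /cosine_law /chord2 /sn kE ltxx.
move=> h; have -> : d ^+ 2 = 4 * (d / 2) ^+ 2 by field.
rewrite h; transitivity (a ^+ 2 * (t ^+ 2 + u ^+ 2) + e ^+ 2 - 2 * a * e * t).
  by ring.
by rewrite tu; field.
Qed.

Lemma cosine_law_between a e t : 0 <= sn k a -> 0 <= sn k e ->
  -1 <= t <= 1 ->
  chord2 k (a - e) <= cosine_law k a e t <= chord2 k (a + e).
Proof.
move=> a0 e0 /andP[t1 t2]; rewrite -cosine_lawB -cosine_lawD /cosine_law.
have ae : 0 <= sn k a * sn k e by exact: mulr_ge0.
by apply/andP; split; nra.
Qed.

(** By continuity of [chord2]: the extreme angles correspond to the third
    sides |a - e| and a + e. *)
Lemma cosine_law_dist_exists r a e t : model_radius r -> 0 <= a -> 0 <= e ->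
  a + e <= r -> -1 <= t <= 1 ->
  exists2 d, 0 <= d <= a + e & chord2 k d = cosine_law k a e t.
Proof.
move=> hr a0 e0 aer t1.
have sa : 0 <= sn k a by apply: (sn_ge0 hr); lra.
have se : 0 <= sn k e by apply: (sn_ge0 hr); lra.
have /andP[h1 h2] := cosine_law_between sa se t1.
have [|||c hc1 hc2] := @IVT _ (chord2 k) 0 (a + e) (cosine_law k a e t).
- lra.
- by apply: continuous_subspaceT => x; exact: continuous_chord2.
- rewrite chord2_0 ge_min le_max h2 orbT andbT.
  apply/orP; left; apply: le_trans h1; by apply: mulr_ge0 => //; exact: sqr_ge0.
- by exists c => //; move: hc1; rewrite in_itv.
Qed.

(** Three lengths satisfying the triangle inequalities are the sides of a
    triangle: solve the law of cosines, affine in the cosine t, for t. *)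
Lemma cosine_exists r a e d : model_radius r -> 0 < a -> 0 < e ->
  a + e <= r -> `|a - e| <= d -> d <= a + e ->
  exists2 t, -1 <= t <= 1 & chord2 k d = cosine_law k a e t.
Proof.
move=> hr a0 e0 aer d1 d2.
have sa : 0 < sn k a by apply: (sn_gt0 hr); lra.
have se : 0 < sn k e by apply: (sn_gt0 hr); lra.
have h1 : chord2 k (a - e) <= chord2 k d.
  have -> : chord2 k (a - e) = chord2 k `|a - e|.
    by case: (ger0P (a - e)) => // _; rewrite chord2N.
  by apply: (chord2_le hr) => //; lra.
have h2 : chord2 k d <= chord2 k (a + e).
  by apply: (chord2_le hr) => //; apply: le_trans d1.
move: h1 h2; rewrite -cosine_lawB -cosine_lawD /cosine_law => h1 h2.
have ae : 0 < sn k a * sn k e by exact: mulr_gt0.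
exists ((chord2 k a + chord2 k e - k / 2 * (chord2 k a * chord2 k e) -
  chord2 k d) / (2 * (sn k a * sn k e))); last by field; lra.
rewrite ler_pdivlMr ?ler_pdivrMr; lra.
Qed.

End ModelPlane.

Section Hinge.
Variables (R : realType) (M : metricType R) (k r : R) (U : set M).
Variable (cmp : R -> R -> Prop).
Hypotheses (hr : model_radius k r) (hcmp : triangle_comparison k U cmp).

(** Comparison in the form used below.  The comparison triangle is placed with
    the vertex of b at the origin and that of c on the first axis, so that t is
    the cosine of the comparison angle at b and d is the distance of a hinge
    with the same angle. *)
Lemma hinge (a b c : M) (fab fbc fca : R -> M) :
  geodesic U a b fab -> geodesic U b c fbc -> geodesic U c a fca ->
  0 < mdist a b -> 0 < mdist b c -> mdist a b + mdist b c <= r / 2 ->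
  exists t, [/\ -1 <= t <= 1,
    chord2 k (mdist a c) = cosine_law k (mdist a b) (mdist b c) t &
    forall s, 0 <= s <= 1 -> exists d, [/\ 0 <= d <= r,
      chord2 k d = cosine_law k (mdist a b) (s * mdist b c) t &
      cmp (mdist a (fbc s)) d]].
Proof.
move=> gab gbc gca; set A := mdist a b; set L := mdist b c => A0 L0 AL.
have [r0 hr1 _] := hr.
have B1 : `|A - L| <= mdist a c.
  rewrite ler_norml; have := metric_triangle b a c; have := metric_triangle a c b.
  by rewrite (metric_sym c b) (metric_sym b a) -/A -/L; lra.
have B2 : mdist a c <= A + L by exact: metric_triangle.
have ALr : A + L <= r by lra.
have [t t1 hB] := cosine_exists hr A0 L0 ALr B1 B2.
exists t; split => // s s01.
have /andP[s0 s1] := s01.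
have sL0 : 0 <= s * L by exact: mulr_ge0 s0 (ltW L0).
have sL1 : s * L <= L by apply: ler_piMl => //; exact: ltW.
have [|d d0 hd] := @cosine_law_dist_exists R k r A (s * L) t hr (ltW A0) sL0 _ t1.
  by lra.
exists d; split => //; first by lra.
pose u := Num.sqrt (1 - t ^+ 2).
have tu : t ^+ 2 + u ^+ 2 = 1.
  rewrite sqr_sqrtr; first by ring.
  have /andP[tm tp] := t1.
  rewrite (_ : 1 - t ^+ 2 = (1 - t) * (1 + t)); last by ring.
  by apply: mulr_ge0; lra.
have one0 : (1 : R) ^+ 2 + 0 ^+ 2 = 1 by ring.
pose a' := polar k A t u; pose b' := polar k 0 1 0.
pose c' := polar k L 1 0; pose d' := polar k (s * L) 1 0.
have [_ _ gU gd] := gbc; have [fbc0 fbc1 _ _] := gbc.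
have bd : mdist b (fbc s) = s * L.
  by rewrite -fbc0 gd ?lexx ?ler01// sub0r normrN ger0_norm.
have dc : mdist (fbc s) c = (1 - s) * L.
  by rewrite -fbc1 gd ?lexx ?ler01// distrC ger0_norm// subr_ge0.
have ad : model_dist k a' d' = d.
  by apply: (model_dist_polar hr tu) => //; lra.
have side e : 0 <= e <= r -> model_dist k b' (polar k e 1 0) = e.
  move=> e0; apply: (model_dist_polar hr one0) => //.
  by rewrite cosine_lawB sub0r chord2N.
rewrite -ad; apply: (hcmp gab gbc gca _ (a' := a') (b' := b') (c' := c')) => //.
- rewrite -/A -/L (metric_sym c a).
  have : Num.sqrt k * (A + L + mdist a c) <= Num.sqrt k * r.
    by rewrite ler_wpM2l ?sqrtr_ge0//; lra.
  by have := pi_gt0 R; rewrite [_ * Num.sqrt k]mulrC; lra.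
- exact: polar_model_plane.
- exact: polar_model_plane.
- exact: polar_model_plane.
- exact: polar_model_plane.
- apply: (model_dist_polar hr tu); first by rewrite -/A; lra.
  by rewrite /cosine_law chord2_0 sn0; ring.
- by apply: side; rewrite -/L; lra.
- rewrite model_dist_sym metric_sym; apply: (model_dist_polar hr tu) => //.
  by rewrite mdist_ge0/=; lra.
- by rewrite bd; apply: side; lra.
- rewrite dc; apply: (model_dist_polar hr one0).
    by rewrite mulrBl mul1r; lra.
  rewrite cosine_lawB mulrBl mul1r -chord2N; congr chord2; ring.
Qed.

End Hinge.

(** * Calculus on an interval *)

Section Primitive.
Variable R : realType.
Implicit Types (F g f df : R -> R) (a b : R).
Local Notation leb := (@lebesgue_measure R).

(** The speed of a curve in a chart makes sense only as long as the curve stays in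
    the chart, so continuity is assumed on [0, 1] only. *)
Lemma primitive_exists g : {within `[0, 1], continuous g} ->
  exists F, [/\ F 0 = 0, F 1 = \int[leb]_(t in `[0, 1]) g t,
    {within `[0, 1], continuous F} &
    forall t : R, 0 < t < 1 -> is_derive t 1 F (g t)].
Proof.
move=> hg.
have gi : leb.-integrable `[0, 1] (EFin \o g).
  by apply: continuous_compact_integrable => //; exact: segment_compact.
exists (fun x => \int[leb]_(t in `[0, x]) g t); split => //.
- by rewrite set_itv1 Rintegral_set1.
- exact: parameterized_integral_continuous ler01 gi.
- move=> t /andP[t0 t1].
  have gt : {for t, continuous g}.
    have : {within `]0, 1[, continuous g}.
      by apply: continuous_subspaceW hg; apply: subset_itv_oo_cc.
    rewrite continuous_open_subspace; last exact: interval_open.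
    by apply; rewrite inE/= in_itv/= t0.
  have [d1 d2] := @continuous_FTC1_closed R g 0 t 1 t1 gi t0 gt.
  split; first exact: d1.
  by rewrite -derive1E; exact: d2.
Qed.

Lemma ge0_derive_le f df a b : a <= b ->
  {within `[a, b], continuous f} ->
  (forall t : R, a < t < b -> is_derive t 1 f (df t)) ->
  (forall t : R, a < t < b -> 0 <= df t) -> f a <= f b.
Proof.
rewrite le_eqVlt => /predU1P[->//|ab] cf hf hdf.
have hf' x : x \in `]a, b[ -> is_derive x 1 f (df x).
  by rewrite in_itv; exact: hf.
have [c] := MVT ab hf' cf.
rewrite in_itv/= => cab h; rewrite -subr_ge0 h mulr_ge0 ?hdf//.
by rewrite subr_ge0 ltW.
Qed.

(** Mean value inequality, from the monotonicity of F - f and F + f. *)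
Lemma derive_dist_le f df F g a b : a <= b ->
  {within `[a, b], continuous f} -> {within `[a, b], continuous F} ->
  (forall t : R, a < t < b -> is_derive t 1 f (df t)) ->
  (forall t : R, a < t < b -> is_derive t 1 F (g t)) ->
  (forall t : R, a < t < b -> `|df t| <= g t) -> `|f b - f a| <= F b - F a.
Proof.
move=> ab cf cF hf hF hdf.
have h1 : F a - f a <= F b - f b.
  apply: (@ge0_derive_le (F - f) (fun t => g t - df t)) => //.
  - by move=> x; apply: cvgB; [exact: cF|exact: cf].
  - by move=> t tab; apply: is_deriveB; [exact: hF|exact: hf].
  - by move=> t /hdf; rewrite ler_norml; lra.
have h2 : F a + f a <= F b + f b.
  apply: (@ge0_derive_le (F + f) (fun t => g t + df t)) => //.
  - by move=> x; apply: cvgD; [exact: cF|exact: cf].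
  - by move=> t tab; apply: is_deriveD; [exact: hF|exact: hf].
  - by move=> t /hdf; rewrite ler_norml; lra.
by rewrite ler_norml; lra.
Qed.

(** Continuous induction: a property that is inherited by t from all smaller
    parameters, and then extends a bit beyond t, holds on [0, 1]. *)
Lemma real_induction (P : R -> Prop) :
  (forall t, 0 <= t <= 1 -> (forall s, 0 <= s < t -> P s) -> P t /\
     exists2 d, 0 < d & forall s, 0 <= s <= 1 -> t <= s < t + d -> P s) ->
  forall t, 0 <= t <= 1 -> P t.
Proof.
move=> hP t t01; apply: contrapT => nPt.
pose B := [set s | 0 <= s <= 1 /\ ~ P s].
have Bt : B t by [].
have B0 : lbound B 0 by move=> s [/andP[]].
have iB : has_inf B by split; [exists t|exists 0].
have t0 : inf B <= t by apply: ge_inf => //; exists 0.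
have b0 : 0 <= inf B by apply: lb_le_inf => //; exists t.
have [||Pi [d d0 hd]] := hP (inf B).
- by rewrite b0/= (le_trans t0)//; case/andP: t01.
- move=> s /andP[s0 sB]; apply: contrapT => nPs.
  have : inf B <= s.
    apply: ge_inf; first by exists 0.
    split=> //; rewrite s0/=; case/andP: t01 => _; apply: le_trans.
    exact: le_trans (ltW sB) t0.
  by rewrite leNgt sB.
have [s [s01 nPs] sd] := inf_adherent d0 iB.
apply: (nPs); apply: hd => //; rewrite sd andbT.
by apply: ge_inf; [exists 0|split].
Qed.

End Primitive.

(** * Speed of curves in a chart *)

Section MatrixLimits.
Variables (R : realType) (n : nat).

Lemma bilinE (g : 'M[R]_n) v w :
  bilin g v w = \sum_j (\sum_i v 0 i * g i j) * w 0 j.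
Proof. by rewrite /bilin mxE; apply: eq_bigr => j _; rewrite !mxE. Qed.

Lemma bilinZ (g : 'M[R]_n) a v : bilin g (a *: v) (a *: v) = a ^+ 2 * bilin g v v.
Proof.
by rewrite /bilin linearZ/= -!scalemxAl -!scalemxAr scalerA mxE expr2.
Qed.

Lemma cvg_entry (p q : nat) (T : Type) (F : set_system T) (FF : Filter F)
    (G : T -> 'M[R]_(p, q)) (g : 'M[R]_(p, q)) i j :
  G x @[x --> F] --> g -> G x i j @[x --> F] --> g i j.
Proof.
move=> Gg; apply: (@continuous_cvg _ _ _ _ FF _ (fun N : 'M[R]_(p, q) => N i j)) => //; exact: coord_continuous.
Qed.

Lemma cvg_bilin (T : Type) (F : set_system T) (FF : Filter F)
    (G : T -> 'M[R]_n) (v w : T -> 'rV[R]_n) (g : 'M[R]_n) (v0 w0 : 'rV[R]_n) :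
  G x @[x --> F] --> g -> v x @[x --> F] --> v0 -> w x @[x --> F] --> w0 ->
  bilin (G x) (v x) (w x) @[x --> F] --> bilin g v0 w0.
Proof.
move=> hG hv hw; rewrite bilinE; under eq_fun do rewrite bilinE.
apply: cvg_big => [|j _]; first exact: add_continuous.
apply: cvgM; last exact: cvg_entry.
apply: cvg_big => [|i _]; first exact: add_continuous.
by apply: cvgM; exact: cvg_entry.
Qed.

End MatrixLimits.

(** Composition when the outer function is only continuous on a subset that
    contains the values of the inner one. *)
Lemma within_comp (U V W : topologicalType) (A : set U) (B : set V)
    (f : U -> V) (g : V -> W) : (forall x, A x -> B (f x)) ->
  {within A, continuous f} -> {within B, continuous g} ->
  {within A, continuous (g \o f)}.
Proof.
move=> AB /subspace_continuousP cf /subspace_continuousP cg.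
apply/subspace_continuousP => x Ax; apply: cvg_comp (cg _ (AB _ Ax)).
move=> P /= hP; have := cf _ Ax _ hP; rewrite /nbhs/= /within/= => h.
by near=> y => Ay; apply: (near h y) => //; exact: AB.
Unshelve. all: by end_near. Qed.

Section Curves.
Variables (R : realType) (n : nat) (M : topologicalType).
Variable (S : riemannian_structure R n M).
Local Notation img i := (chart (r := S) i @` dom i).
Implicit Types (i j : Defs.index S) (c : R -> 'rV[R]_n).

Definition speed i c (t : R) : R :=
  Num.sqrt (bilin (rmetric i (c t)) (derive1 c t) (derive1 c t)).

Lemma continuous_on_open (U V : topologicalType) (A : set U) (f : U -> V) x :
  open A -> {within A, continuous f} -> A x -> {for x, continuous f}.
Proof.
move=> oA; rewrite continuous_open_subspace// => h Ax; apply: h.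
by rewrite inE.
Qed.

Lemma rmetric_continuous_at i u : img i u -> {for u, continuous (rmetric i)}.
Proof. by apply: continuous_on_open; [exact: chart_open|exact: rmetric_continuous]. Qed.

Lemma param_continuous_at i u : img i u -> {for u, continuous (param (r := S) i)}.
Proof. by apply: continuous_on_open; [exact: chart_open|exact: param_continuous]. Qed.

Lemma chart_continuous_at i x : dom i x -> {for x, continuous (chart (r := S) i)}.
Proof. by apply: continuous_on_open; [exact: dom_open|exact: chart_continuous]. Qed.

Lemma C1_curve_continuous c : C1_curve c -> continuous c.
Proof.
move=> [dc _] t; apply/differentiable_continuous/derivable1_diffP; exact: dc.
Qed.

Lemma speed_continuous_at i c t : C1_curve c -> img i (c t) ->
  {for t, continuous (speed i c)}.
Proof.
move=> hc ict; apply: (@continuous_comp _ _ _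
  (fun t => bilin (rmetric i (c t)) (derive1 c t) (derive1 c t)) Num.sqrt).
  apply: cvg_bilin; try exact: hc.2.
  apply: (@continuous_comp _ _ _ c (rmetric i)).
    exact: C1_curve_continuous.
  exact: rmetric_continuous_at.
exact: sqrt_continuous.
Qed.

Lemma affine_curve c (a b : R) : C1_curve c ->
  C1_curve (fun u => c (a + b * u)) /\
  forall t, derive1 (fun u => c (a + b * u)) t = b *: derive1 c (a + b * t).
Proof.
move=> [dc cc].
have daff t : is_derive t (1 : R) (fun u : R => a + b * u) b.
  by apply: is_derive_eq; rewrite /GRing.scale/= add0r mul1r mulr1.
have faff t : differentiable (fun u : R => a + b * u) t.
  by apply/derivable1_diffP; have [] := daff t.
have fc t : differentiable c t by apply/derivable1_diffP; exact: dc.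
have e t : derive1 (fun u => c (a + b * u)) t = b *: derive1 c (a + b * t).
  rewrite [LHS](derive1E' (differentiable_comp (faff t) (fc _))).
  rewrite (diff_comp (faff t) (fc _))/= derive1E'//.
  have -> : 'd (fun u : R => a + b * u) t 1 = b.
    by rewrite -deriveE//; have [] := daff t.
  have h : 'd c (a + b * t) (b *: (1 : R^o)) = b *: 'd c (a + b * t) 1.
    exact: linearZ.
  by rewrite -h; congr ('d c _ _); rewrite [RHS]mulr1.
split; last exact: e.
split=> [t|].
  apply/derivable1_diffP; exact: (differentiable_comp (faff t) (fc _)).
move=> t; rewrite (_ : derive1 _ = fun t => b *: derive1 c (a + b * t)); last exact/funext.
apply: cvgZr; apply: (@continuous_comp _ _ _ (fun u => a + b * u) (derive1 c)).
  by apply: differentiable_continuous.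
exact: cc.
Qed.

Lemma affine_within (F : R -> R) (a b : R) : 0 <= a -> a <= b -> b <= 1 ->
  {within `[0, 1], continuous F} ->
  {within `[0, 1], continuous (fun u : R => F (a + (b - a) * u))}.
Proof.
move=> a0 ab b1 cF.
have h : {within `[0, 1], continuous (fun u : R => a + (b - a) * u)}.
  apply: continuous_subspaceT => x; apply: cvgD; first exact: cvg_cst.
  by apply: cvgM; [exact: cvg_cst|exact: cvg_id].
apply: (within_comp _ h cF) => u /=; rewrite !in_itv/= => /andP[u0 u1].
by apply/andP; split; nra.
Qed.

End Curves.

(** * Length and distance *)

Section CurveLength.
Variables (R : realType) (n : nat) (M : topologicalType).
Variable (S : riemannian_structure R n M).
Local Notation img i := (chart (r := S) i @` dom i).
Implicit Types (i j : Defs.index S) (c : R -> 'rV[R]_n).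

Definition in_chart i c := forall t : R, 0 <= t <= 1 -> img i (c t).

Lemma speed_ge0 i c t : 0 <= speed i c t.
Proof. exact: sqrtr_ge0. Qed.

Lemma speed_primitive i c : C1_curve c -> in_chart i c ->
  exists F : R -> R, [/\ F 0 = 0, F 1 = chart_length i c,
    {within `[0, 1], continuous F} &
    forall t : R, 0 < t < 1 -> is_derive t 1 F (speed i c t)].
Proof.
move=> hc ic; apply: primitive_exists.
apply: continuous_in_subspaceT => t; rewrite inE/= in_itv/= => t01.
exact: speed_continuous_at hc (ic _ t01).
Qed.

Lemma speed_affine i c a b t : C1_curve c -> 0 <= b ->
  speed i (fun u => c (a + b * u)) t = b * speed i c (a + b * t).
Proof.
move=> hc b0; rewrite /speed (affine_curve a b hc).2 bilinZ.
by rewrite sqrtrM ?sqr_ge0// sqrtr_sqr ger0_norm.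
Qed.

(** Change of variables in the length integral.  Both sides are values at 1 of
    functions on [0, 1] with the same derivative. *)
Lemma affine_chart_length i c (F : R -> R) (a b : R) : C1_curve c -> in_chart i c ->
  {within `[0, 1], continuous F} ->
  (forall t : R, 0 < t < 1 -> is_derive t 1 F (speed i c t)) ->
  0 <= a -> a < b -> b <= 1 ->
  chart_length i (fun u => c (a + (b - a) * u)) = F b - F a.
Proof.
move=> hc ic cF dF a0 ab b1.
have ba0 : 0 <= b - a by rewrite subr_ge0 ltW.
have aff01 (t : R) : 0 <= t <= 1 -> 0 <= a + (b - a) * t <= 1.
  by move=> /andP[t0 t1]; apply/andP; split; nra.
have [hc' _] := affine_curve a (b - a) hc.
have ic' : in_chart i (fun u => c (a + (b - a) * u)).
  by move=> t /aff01; exact: ic.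
have [G [G0 G1 cG dG]] := speed_primitive hc' ic'.
pose H (u : R) : R := F (a + (b - a) * u).
have cH : {within `[0, 1], continuous H} := affine_within a0 (ltW ab) b1 cF.
have dH (t : R) : 0 < t < 1 ->
    is_derive t 1 H (speed i (fun u => c (a + (b - a) * u)) t).
  move=> /andP[t0 t1]; rewrite speed_affine// mulrC.
  apply: (@is_derive1_comp _ F (fun u => a + (b - a) * u)).
    by apply: dF; apply/andP; split; nra.
  by apply: is_derive_eq; rewrite /GRing.scale/= add0r mul1r mulr1.
have := @derive_dist_le _ _ _ _ _ 0 1 ler01 cH cG dH dG.
have := @derive_dist_le _ _ _ _ _ 0 1 ler01 cG cH dG dH.
have e (t : R) : 0 < t < 1 -> `|speed i (fun u => c (a + (b - a) * u)) t| <=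
    speed i (fun u => c (a + (b - a) * u)) t.
  by move=> _; rewrite ger0_norm// speed_ge0.
move=> /(_ e) + /(_ e).
rewrite G0 G1 /H mulr0 addr0 mulr1 (_ : a + (b - a) = b); last by ring.
by rewrite !ler_norml; lra.
Qed.

(** Arclength along one piece, together with the fact that each sub-arc is itself
    an admissible curve. *)
Lemma piece_length_function i c : C1_curve c -> in_chart i c ->
  exists F : R -> R, [/\ F 0 = 0, F 1 = chart_length i c,
    {within `[0, 1], continuous F},
    forall t : R, 0 < t < 1 -> is_derive t 1 F (speed i c t) &
    forall a b, 0 <= a -> a <= b -> b <= 1 ->
      curve_length S (param i (c a)) (param i (c b)) (F b - F a)].
Proof.
move=> hc ic; have [F [F0 F1 cF dF]] := speed_primitive hc ic.
exists F; split => // a b a0; rewrite le_eqVlt => /predU1P[->|ab] b1.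
  by rewrite subrr; constructor.
rewrite -(affine_chart_length hc ic cF dF a0 ab b1) -[chart_length _ _]addr0.
have e0 : c a = c (a + (b - a) * 0) by rewrite mulr0 addr0.
have e1 : c b = c (a + (b - a) * 1) by rewrite mulr1 subrKC.
rewrite [in param i (c a)]e0 [in X in curve_length _ _ X _]e1.
apply: (@curve_length_cons _ _ _ S i (fun u => c (a + (b - a) * u))).
- exact: (affine_curve a (b - a) hc).1.
- move=> t /andP[t0 t1]; apply: ic; apply/andP; split; nra.
- exact: curve_length_nil.
Qed.

Lemma chart_length_ge0 i c : 0 <= chart_length i c.
Proof. by apply: Rintegral_ge0 => t _; exact: sqrtr_ge0. Qed.

Lemma curve_length_ge0 x y l : curve_length S x y l -> 0 <= l.
Proof. by elim=> // i c z m _ _ _ m0; rewrite addr_ge0// chart_length_ge0. Qed.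

End CurveLength.

Section Distance.
Variables (R : realType) (n : nat) (M : metricType R).
Variable (S : riemannian_structure R n M).
Hypothesis hdist : is_riemannian_distance S.
Local Notation img i := (chart (r := S) i @` dom i).

Lemma mdist_le_length (x y : M) l : curve_length S x y l -> mdist x y <= l.
Proof.
move=> h; rewrite (hdist x y).2; apply: ge_inf => //.
by exists 0 => m; exact: curve_length_ge0.
Qed.

Lemma short_curve_exists (x y : M) e : 0 < e ->
  exists2 l, curve_length S x y l & l < mdist x y + e.
Proof.
move=> e0; have [ne ->] := hdist x y.
have [|l hl le] := inf_adherent e0 _ (E := [set l | curve_length S x y l]).
  by split=> //; exists 0 => m; exact: curve_length_ge0.
by exists l.
Qed.

Lemma continuous_mdist (z : M) : continuous (fun u : M => mdist z u).
Proof.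
move=> u; apply/cvgrPdist_le => e e0; near=> v.
have : ball u e v by near: v; exact: nbhsx_ballx.
rewrite ballEmdist/= => uv; rewrite ler_norml.
have := metric_triangle z u v; have := metric_triangle z v u.
rewrite (metric_sym v u); lra.
Unshelve. all: by end_near. Qed.

(** The trace of a curve from x to y of length l, as a set of points with
    arclength parameters.  Only two properties of the curve are used later:
    distances are bounded by differences of parameters, and the intermediate
    value property.  Unlike parametrized curves, such traces are concatenated by
    taking a union. *)
Lemma curve_trace (x y : M) l : curve_length S x y l ->
  exists G : set (M * R), [/\ forall u s, G (u, s) -> 0 <= s <= l,
    forall u s v t, G (u, s) -> G (v, t) -> mdist u v <= `|s - t|,
    G (x, 0), G (y, l) &
    forall h : M -> R, continuous h -> h x <= 0 <= h y ->
      exists u s, G (u, s) /\ h u = 0].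
Proof.
elim=> {x y l} [x|i c y l hc ic hl [G [G1 G2 Gx Gy Gh]]].
  exists [set (x, 0)]; split => //.
  - by move=> u s [_ ->]; rewrite lexx.
  - by move=> u s v t [-> ->] [-> ->]; rewrite mdistxx.
  - by move=> h hc /le_anti/esym hx; exists x, 0.
have [F [F0 F1 cF dF FL]] := piece_length_function hc ic.
have Fd a b : 0 <= a -> a <= b -> b <= 1 ->
    mdist (param i (c a)) (param i (c b)) <= F b - F a.
  by move=> a0 ab b1; apply: mdist_le_length; exact: FL.
have Fnd a b : 0 <= a -> a <= b -> b <= 1 -> F a <= F b.
  by move=> a0 ab b1; rewrite -subr_ge0 (le_trans _ (Fd a b a0 ab b1))// mdist_ge0.
have l0 := curve_length_ge0 hl.
pose G' : set (M * R) := [set p | exists2 t : R, 0 <= t <= 1 &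
   p = (param i (c t), F t)].
rewrite -F1; exists (G' `|` [set p | G (p.1, p.2 - F 1)]).
have GG u s v t : G' (u, s) -> G (v, t - F 1) -> mdist u v <= `|s - t|.
  move=> [a /andP[a0 a1] [-> ->]] hv.
  have := Fd a 1 a0 a1 (lexx _); have := G2 _ _ _ _ Gx hv.
  have := G1 _ _ hv => /andP[tF _].
  rewrite sub0r normrN ger0_norm// => h1 h2.
  have := metric_triangle (param i (c a)) (param i (c 1)) v => h3.
  by rewrite ler_normr; lra.
split.
- move=> u s [[t /andP[t0 t1] [_ ->]]|/= /G1].
    by have := Fnd 0 t (lexx _) t0 t1; have := Fnd t 1 t0 t1 (lexx _); lra.
  by have := Fnd 0 1 (lexx _) ler01 (lexx _); rewrite F0; lra.
- move=> u s v t [hu|hu] [hv|hv].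
  + case: hu hv => a /andP[a0 a1] [-> ->] [b /andP[b0 b1] [-> ->]].
    have [ab|/ltW ba] := leP a b; rewrite ler_normr.
      by have := Fd a b a0 ab b1; lra.
    by have := Fd b a b0 ba a1; rewrite metric_sym; lra.
  + exact: GG.
  + by rewrite metric_sym distrC; exact: GG.
  + by have := G2 _ _ _ _ hu hv; rewrite opprB addrA subrK.
- by left; exists 0; rewrite ?lexx ?ler01// F0.
- by right; rewrite /= addrAC subrr add0r.
- move=> h ch /andP[hx hy].
  have [h1|h1] := leP 0 (h (param i (c 1))).
    have [||t] := @IVT _ (fun t => h (param i (c t))) 0 1 0 ler01.
    + apply: continuous_in_subspaceT => t; rewrite inE/= in_itv/= => t01.
      apply: (@continuous_comp _ _ _ (param i \o c) h); last exact: ch.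
      apply: continuous_comp; first exact: C1_curve_continuous.
      by apply: param_continuous_at; exact: ic.
    + by rewrite ge_min hx/= le_max h1 orbT.
    + rewrite in_itv/= => t01 ht; exists (param i (c t)), (F t); split => //.
      by left; exists t.
  have [|u [s [hu us]]] := Gh h ch; first by rewrite ltW.
  by exists u, (s + F 1); split => //; right; rewrite /= addrK.
Qed.

End Distance.

(** * Geodesics *)

(** The triangle inequality and the symmetry of distances over a real type, so
    that all distances are taken over one and the same ordered structure, as
    linear arithmetic requires. *)
Lemma dist_triangle (R : realType) (M : metricType R) (x y z : M) :
  mdist x z <= mdist x y + mdist y z.
Proof. exact: metric_triangle. Qed.

Lemma dist_sym (R : realType) (M : metricType R) (x y : M) :
  mdist x y = mdist y x.
Proof. exact: metric_sym. Qed.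

Section Geodesics.
Variables (R : realType) (n : nat) (M : metricType R).
Variable (S : riemannian_structure R n M).
Hypothesis hdist : is_riemannian_distance S.

(** On a curve of length less than |xy| + e, choose for each t a point at distance
    t |xy| from x.  Its arclength parameter is then between t |xy| and
    t |xy| + e, so the chosen points are almost as close as on a geodesic. *)
Lemma almost_geodesic (x y : M) e : 0 < e ->
  exists f : R -> M, forall t : R, 0 <= t <= 1 ->
    [/\ mdist x (f t) = t * mdist x y, mdist (f t) y <= (1 - t) * mdist x y + e &
      forall s : R, 0 <= s <= 1 ->
      mdist (f s) (f t) <= `|s - t| * mdist x y + e].
Proof.
move=> e0; set T := mdist x y; have T0 : 0 <= T by exact: mdist_ge0.
have [l hl lT] := short_curve_exists hdist x y e0; rewrite -/T in lT.
have [G [G1 G2 Gx Gy Gh]] := curve_trace hdist hl.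
have pt (t : R) : exists us : M * R, 0 <= t <= 1 -> G us /\ mdist x us.1 = t * T.
  have [/andP[t0 t1]|] := boolP (0 <= t <= 1); last by exists (x, 0).
  have [||u [s [Gu hu]]] := Gh (fun u => mdist x u - t * T).
  - move=> u; apply: cvgB; [exact: continuous_mdist|exact: cvg_cst].
  - by rewrite mdistxx -/T; apply/andP; split; nra.
  - by exists (u, s) => _; split=> //=; lra.
have {pt}[f hf] := choice pt.
have hs (t : R) : 0 <= t <= 1 -> t * T <= (f t).2 <= t * T + e /\
   mdist (f t).1 y <= (1 - t) * T + e.
  move=> t01; have [Gt xt] := hf t t01.
  case: (f t) Gt xt => u s /= Gt xt.
  have h2 := G2 _ _ _ _ Gx Gt; have h3 := G2 _ _ _ _ Gt Gy.
  have /andP[s0 sl] := G1 _ _ Gt.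
  rewrite sub0r normrN ger0_norm// in h2.
  rewrite distrC ger0_norm ?subr_ge0// in h3.
  have h1 := dist_triangle x u y; rewrite -/T xt in h1 h2.
  by split; [apply/andP; split|]; lra.
exists (fst \o f) => t t01 /=; have [/andP[h1 h2] h3] := hs t t01.
have [Gt xt] := hf t t01; split => // s s01.
have [/andP[k1 k2] _] := hs s s01; have [Gs xs] := hf s s01.
have := G2 (f s).1 (f s).2 (f t).1 (f t).2.
rewrite -!surjective_pairing => /(_ Gs Gt) h; apply: le_trans h _.
have -> : `|s - t| * T = `|s * T - t * T| by rewrite -mulrBl normrM (ger0_norm T0).
rewrite ler_norml; have := ler_norm (s * T - t * T).
by have := ler_norm (- (s * T - t * T)); rewrite normrN; lra.
Qed.

(** A cluster point, in a product of copies of the compact set, of almost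
    geodesics with error tending to 0; the upper bounds on distances pass to the
    limit and force equality by the triangle inequality. *)
Lemma geodesic_exists (K : set M) (x y : M) : compact K ->
  (forall z, mdist x z <= mdist x y -> K z) -> exists f, geodesic K x y f.
Proof.
move=> cK xyK; set T := mdist x y; have T0 : 0 <= T by exact: mdist_ge0.
have Kx : K x by apply: xyK; rewrite mdistxx.
have Ky : K y by exact: xyK.
have pos (k : nat) : 0 < k.+1%:R^-1 :> R by rewrite invr_gt0 ltr0n.
have [f_ hf_] := choice (fun k => almost_geodesic x y (pos k)).
(* Tychonoff's theorem asks for values in K at all real parameters. *)
pose clamp k (t : R) := if 0 <= t <= 1 then f_ k t else x.
have clampK k t : K (clamp k t).
  rewrite /clamp; case: ifPn => // t01; apply: xyK.
  by have [-> _ _] := hf_ k t t01; case/andP: t01 => *; rewrite -/T; nra.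
have := @tychonoff R (fun _ => M) (fun _ => K) (fun _ => cK).
move=> /(_ (clamp @ \oo) _) [|f [fK fcl]].
  by exists 0 => // k _ t; exact: clampK.
have key (s t d : R) : 0 <= s <= 1 -> 0 <= t <= 1 -> 0 < d ->
    exists k, [/\ k.+1%:R^-1 < d, mdist (f s) (f_ k s) < d &
      mdist (f t) (f_ k t) < d].
  move=> s01 t01 d0.
  have near_k : \forall k \near \oo, k.+1%:R^-1 < d.
    have := @cvg_harmonic R => /cvgrPdist_lt /(_ _ d0); apply: filterS => k.
    by rewrite /harmonic sub0r normrN ger0_norm //; apply: ltW; exact: pos.
  have nb u : nbhs f (fun g : forall _ : R, M => ball (f u) d (g u)).
    exact: (@proj_continuous R (fun _ => M) u f _ (nbhsx_ballx (f u) d d0)).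
  have [] := fcl (clamp @` [set k | k.+1%:R^-1 < d])
    (fun g => ball (f s) d (g s) /\ ball (f t) d (g t)).
  - by apply: filterS near_k => k hk; exists k.
  - by apply: filterI; exact: nb.
  move=> g [[k kd <-] []]; rewrite !ballEmdist /clamp s01 t01 => h1 h2.
  by exists k.
have fx (t : R) : 0 <= t <= 1 -> mdist x (f t) <= t * T.
  move=> t01; apply/ler_addgt0Pl => e e0.
  have [k [_ h _]] := key t t e t01 t01 e0.
  have [h1 _ _] := hf_ k t t01; rewrite -/T in h1.
  have := dist_triangle x (f_ k t) (f t).
  by rewrite (dist_sym (f_ k t)); lra.
have fy (t : R) : 0 <= t <= 1 -> mdist (f t) y <= (1 - t) * T.
  move=> t01; apply/ler_addgt0Pl => e e0.
  have e20 : 0 < e / 2 by lra.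
  have [k [h0 h _]] := key t t _ t01 t01 e20.
  have [_ h1 _] := hf_ k t t01; rewrite -/T in h1.
  have := dist_triangle (f t) (f_ k t) y.
  move: (k.+1%:R^-1) h0 h1 => d h0 h1. lra.
have fst (s t : R) : 0 <= s <= 1 -> 0 <= t <= 1 -> mdist (f s) (f t) <= `|s - t| * T.
  move=> s01 t01; apply/ler_addgt0Pl => e e0.
  have e20 : 0 < e / 3 by lra.
  have [k [h0 h h']] := key s t _ s01 t01 e20.
  have [_ _ /(_ s s01) h1] := hf_ k t t01; rewrite -/T in h1.
  have := dist_triangle (f s) (f_ k s) (f t).
  have := dist_triangle (f_ k s) (f_ k t) (f t).
  rewrite (dist_sym (f_ k t)).
  move: (k.+1%:R^-1) h0 h1 => d h0 h1. lra.
have z01 : 0 <= (0 : R) <= 1 by lra.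
have o01 : 0 <= (1 : R) <= 1 by lra.
exists f; split.
- apply/esym/mdist_positivity/le_anti; rewrite mdist_ge0 andbT.
  by have := fx 0 z01; rewrite mul0r.
- apply/mdist_positivity/le_anti; rewrite mdist_ge0 andbT.
  by have := fy 1 o01; rewrite subrr mul0r.
- by move=> t _; exact: fK.
- move=> s t s01 t01; apply/le_anti; rewrite fst//= -/T.
  have h1 := dist_triangle x (f s) y; have h2 := dist_triangle x (f t) y.
  have := fx s s01; have := fx t t01; have := fy s s01; have := fy t t01.
  have := dist_triangle x (f s) (f t); have := dist_triangle x (f t) (f s).
  rewrite (dist_sym (f t) (f s)) -/T in h1 h2 *.
  by case: (ler0P (s - t)) => _; lra.
Qed.

Lemma compact_dist_min (K : set M) (x : M) : compact K -> K !=set0 ->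
  exists2 q, K q & forall z, K z -> mdist x q <= mdist x z.
Proof.
move=> cK K0.
have cf : {within K, continuous (fun z => mdist x z)}.
  by apply: continuous_subspaceT; exact: continuous_mdist.
have [q qK hq] := compact_EVT_min K0 cK cf.
exists q; first by rewrite inE in qK.
by move=> z Kz; apply: hq; rewrite inE.
Qed.

End Geodesics.

(** * Norm and metric bounds in a chart *)

Section RowVectors.
Variables (R : realType) (n : nat).
Implicit Types (u v : 'rV[R]_n).

Lemma norm_entry_le v k : `|v 0 k| <= `|v|.
Proof.
rewrite [leRHS]mx_normrE.
exact: (le_bigmax 0 (fun ij : 'I_1 * 'I_n => `|v ij.1 ij.2|) (0, k)).
Qed.

Lemma norm_le_entries v b : 0 <= b -> (forall k, `|v 0 k| <= b) -> `|v| <= b.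
Proof.
move=> b0 h; rewrite [leLHS]mx_normrE; apply: bigmax_le => //= -[i k] _ /=.
by rewrite ord1.
Qed.

(** The maximum norm makes the mean value inequality for vectors a statement on
    coordinates. *)
Lemma derive_norm_le (h : R -> 'rV[R]_n) (F g : R -> R) a b : a <= b ->
  {within `[a, b], continuous F} ->
  (forall t : R, a <= t <= b -> derivable h t 1) ->
  (forall t : R, a < t < b -> is_derive t 1 F (g t)) ->
  (forall t : R, a < t < b -> `|derive1 h t| <= g t) ->
  `|h b - h a| <= F b - F a.
Proof.
move=> ab cF dh dF hg.
have entry k : `|(h b - h a) 0 k| <= F b - F a.
  have dhk t : a <= t <= b -> derivable (fun t => h t 0 k) t 1.
    by move=> tab; have /derivable_mxP := dh t tab; apply.
  have ch : {within `[a, b], continuous (fun t => h t 0 k)}.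
    apply: continuous_in_subspaceT => t; rewrite inE/= in_itv/= => tab.
    exact/differentiable_continuous/derivable1_diffP/dhk.
  rewrite !mxE.
  apply: (@derive_dist_le _ _ (fun t => 'D_1 (fun t => h t 0 k) t) _ g _ _ ab ch cF _ dF).
    move=> t /andP[at_ tb]; apply: DeriveDef => //.
    by apply: dhk; rewrite !ltW.
  move=> t tab; apply: le_trans (hg t tab).
  have dt : derivable h t 1 by apply: dh; case/andP: tab => ? ?; rewrite !ltW.
  by rewrite derive1E derive_mx//; have := norm_entry_le ('D_1 h t) k; rewrite derive_mx// !mxE.
have [k|n0] := pickP (fun k : 'I_n => true).
  by move=> _; apply: norm_le_entries => //; apply: le_trans (entry k).
have -> : h b - h a = 0 by apply/rowP => k; have := n0 k.
rewrite normr0 subr_ge0; apply: (ge0_derive_le ab cF dF) => t tab.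
exact: le_trans (hg t tab).
Qed.

Lemma closed_norm_ball (u0 : 'rV[R]_n) r : closed [set u | `|u - u0| <= r].
Proof.
apply: (@preimage_closed _ _ (fun u => `|u - u0|) [set x | x <= r]).
  move=> u _; apply: (@continuous_comp _ _ _ (fun u => u - u0)
    (fun v : 'rV[R]_n => `|v|)); last exact: norm_continuous.
  by apply: (@continuousB _ _ _ (fun v : 'rV[R]_n => v) (cst u0)); [move=> A|exact: cst_continuous].
exact: closed_le.
Qed.

Lemma compact_norm_ball (u0 : 'rV[R]_n) r : compact [set u | `|u - u0| <= r].
Proof.
apply: bounded_closed_compact; last exact: closed_norm_ball.
exists (`|u0| + r); split => [|x hx u /= ur]; first exact: num_real.
rewrite -(subrK u0 u) (le_trans (ler_normD _ _))//.
by move: ur hx; set a := `|u - _|; lra.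
Qed.

Lemma closed_unit_sphere : closed [set v : 'rV[R]_n | `|v| = 1].
Proof.
apply: (@preimage_closed _ _ (fun u : 'rV[R]_n => `|u|) [set x | x = 1]).
  by move=> u _; exact: norm_continuous.
exact: closed_eq.
Qed.

Lemma compact_unit_sphere : compact [set v : 'rV[R]_n | `|v| = 1].
Proof.
apply: (subclosed_compact closed_unit_sphere (@compact_norm_ball 0 1)).
by move=> v /= v1; rewrite subr0 v1.
Qed.

End RowVectors.

Section MetricBounds.
Variables (R : realType) (n : nat) (M : topologicalType).
Variable (S : riemannian_structure R n M).
Local Notation img i := (chart (r := S) i @` dom i).
Implicit Types (i j : Defs.index S).

Lemma bilin0 (g : 'M[R]_n) : bilin g 0 0 = 0.
Proof. by rewrite /bilin !mul0mx mxE. Qed.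

(** Compactness of the product of a closed ball of coordinates and the unit
    sphere. *)
Lemma rmetric_bounds i (u0 : 'rV[R]_n) r :
  [set u | `|u - u0| <= r] `<=` img i -> 0 <= r ->
  exists2 C, 0 < C & forall u v, `|u - u0| <= r ->
    `|v| <= C * Num.sqrt (bilin (rmetric i u) v v) /\
    Num.sqrt (bilin (rmetric i u) v v) <= C * `|v|.
Proof.
move=> sub r0.
pose Q := [set u | `|u - u0| <= r] `*` [set v : 'rV[R]_n | `|v| = 1].
pose f (p : 'rV[R]_n * 'rV[R]_n) := Num.sqrt (bilin (rmetric i p.1) p.2 p.2).
have cQ : compact Q.
  by apply: compact_setX; [exact: compact_norm_ball|exact: compact_unit_sphere].
have cf : {within Q, continuous f}.
  apply: continuous_in_subspaceT => -[u v]; rewrite inE => -[/= ur _].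
  apply: (@continuous_comp _ _ _ (fun p : 'rV[R]_n * 'rV[R]_n =>
    bilin (rmetric i p.1) p.2 p.2) Num.sqrt); last exact: sqrt_continuous.
  apply: cvg_bilin; try exact: cvg_snd.
  apply: (@continuous_comp _ _ _ fst (rmetric i)); first exact: cvg_fst.
  by apply: rmetric_continuous_at; exact: sub.
have [Q0|] := pselect (Q !=set0); last first.
  (* The sphere is empty when n = 0; then v = 0. *)
  move=> Q0; exists 1 => // u v _.
  have -> : v = 0.
    apply: contrapT => /eqP v0; apply: Q0; exists (u0, `|v|^-1 *: v); split => /=.
      by rewrite subrr normr0.
    by rewrite normrZ normfV normr_id mulVf// normr_eq0.
  by rewrite bilin0 sqrtr0 normr0 !mulr0.
have [[u1 v1] q1 h1] := compact_EVT_min Q0 cQ cf.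
have [[u2 v2] q2 h2] := compact_EVT_max Q0 cQ cf.
have f1 : 0 < f (u1, v1).
  move: q1; rewrite inE => -[/= ur nv]; rewrite /f sqrtr_gt0/=.
  apply: rmetric_pos; first exact: sub.
  by apply/eqP => v0; move: nv; rewrite v0 normr0 => /esym/eqP; rewrite oner_eq0.
exists (Num.max (f (u1, v1))^-1 (f (u2, v2))); first by rewrite lt_max invr_gt0 f1.
move=> u v ur; set C := Num.max _ _.
have C0 : 0 < C by rewrite lt_max invr_gt0 f1.
have [->|v0] := eqVneq v 0; first by rewrite bilin0 sqrtr0 normr0 !mulr0.
have nv : 0 < `|v| by rewrite normr_gt0.
pose w := `|v|^-1 *: v.
have Qw : (u, w) \in Q.
  by rewrite inE; split => //=; rewrite normrZ normfV normr_id mulVf// gt_eqF.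
have -> : Num.sqrt (bilin (rmetric i u) v v) = `|v| * f (u, w).
  rewrite (_ : v = `|v| *: w); last by rewrite /w scalerA divff ?scale1r// gt_eqF.
  rewrite bilinZ sqrtrM ?sqr_ge0// sqrtr_sqr /f/= normrZ !normr_id.
  by rewrite normrZ normfV normr_id mulVf ?mulr1// gt_eqF.
have := h1 _ Qw; have := h2 _ Qw => k2 k1; split.
  rewrite mulrCA; apply: ler_peMr; first exact: ltW.
  have Cf : (f (u1, v1))^-1 <= C by rewrite le_max lexx.
  have : (f (u1, v1))^-1 * f (u1, v1) <= C * f (u, w).
    by apply: ler_pM => //; [rewrite invr_ge0|]; exact: ltW.
  by rewrite mulVf ?(lt0r_neq0 f1).
rewrite mulrC ler_wpM2r// (le_trans k2)// le_max lexx orbT//.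
Qed.

End MetricBounds.

(** * Distance and coordinates *)

Section ChartDistance.
Variables (R : realType) (n : nat) (M : metricType R).
Variable (S : riemannian_structure R n M).
Local Notation img i := (chart (r := S) i @` dom i).
Variables (i : Defs.index S) (u0 : 'rV[R]_n) (r C : R).
Hypothesis ball_img : [set u | `|u - u0| <= r] `<=` img i.
Hypothesis C0 : 0 < C.
Hypothesis norm_le : forall u v, `|u - u0| <= r ->
    `|v| <= C * Num.sqrt (bilin (rmetric i u) v v).

Lemma param_img j u : img j u -> dom j (param j u) /\ chart j (param j u) = u.
Proof. by move=> [x jx <-]; rewrite chartK. Qed.

(** Closedness in M, not merely in the chart, is what prevents a short curve from
    escaping from the chart in finite time. *)
Lemma closed_param_ball r1 : r1 <= r ->
  closed (param i @` [set u | `|u - u0| <= r1]).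
Proof.
move=> r1r; apply: compact_closed; first exact: metric_hausdorff.
apply: continuous_compact; last exact: compact_norm_ball.
apply: continuous_subspaceW (@param_continuous _ _ _ S i).
by move=> u /= h; apply: ball_img => /=; apply: le_trans r1r.
Qed.

Section Piece.
Variables (j : Defs.index S) (c : R -> 'rV[R]_n).
Hypotheses (hc : C1_curve c) (jc : in_chart j c).
Let x (t : R) := param j (c t).
Let h (t : R) := chart i (x t).
Hypothesis ix0 : dom i (x 0).
Hypothesis short : `|h 0 - u0| + C * chart_length j c < r.

Let P (t : R) := dom i (x t) /\ `|h t - u0| < r.

Let x_continuous t : 0 <= t <= 1 -> {for t, continuous x}.
Proof.
move=> t01; apply: (@continuous_comp _ _ _ c (param j)).
  exact: C1_curve_continuous.
by apply: param_continuous_at; exact: jc.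
Qed.

Let h_derive t : 0 <= t <= 1 -> P t ->
  derivable h t 1 /\ `|derive1 h t| <= C * speed j c t.
Proof.
move=> t01 [ixt hr]; have [jx ex] := param_img (jc t01).
have tr : (chart j @` (dom j `&` dom i)) (c t) by exists (x t).
have dc : differentiable c t by apply/derivable1_diffP; exact: hc.1.
have [dtau _] := transition_C1 j i; have {}dtau := dtau _ tr.
have dh : differentiable h t := differentiable_comp dc dtau.
split; first exact/derivable1_diffP.
have -> : derive1 h t = 'd (chart i \o param j) (c t) (derive1 c t).
  have dh' : differentiable ((chart i \o param j) \o c) t := dh.
  have e1 := diff_comp dc dtau.
  have e2 := derive1E' dh'.
  have e3 := derive1E' dc.
  rewrite e3.
  apply: (etrans e2).
  exact: (congr1 (fun f : R -> 'rV[R]_n => f 1) e1).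
rewrite /speed (rmetric_transition _ _ tr); apply: norm_le.
exact: ltW.
Qed.

(** As long as the curve stays in the given ball of the chart i, the transition
    map compares its coordinate speed with its Riemannian speed.  A curve that is
    too short to reach the boundary of the ball never leaves it, by continuous
    induction on the parameter. *)
Lemma chart_piece_bound : dom i (x 1) /\ `|h 1 - h 0| <= C * chart_length j c.
Proof.
have [F [F0 F1 cF dF FL]] := piece_length_function hc jc.
have Fle t : 0 <= t <= 1 -> F t <= F 1.
  move=> /andP[t0 t1]; rewrite -subr_ge0.
  exact: curve_length_ge0 (FL t 1 t0 t1 (lexx _)).
(* Up to the first exit time, the displacement is bounded by the length. *)
have est t : 0 <= t <= 1 -> (forall s, 0 <= s <= t -> P s) ->
    `|h t - h 0| <= C * F t.
  move=> /andP[t0 t1] Pt.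
  have -> : C * F t = C * F t - C * F 0 by rewrite F0; ring.
  have in01 (s : R) : 0 <= s <= t -> 0 <= s <= 1 by lra.
  have io01 (s : R) : 0 < s < t -> 0 <= s <= t by lra.
  apply: (@derive_norm_le _ _ h (fun t => C * F t) (fun t => C * speed j c t)) => //.
  - apply: (@continuous_subspaceW _ _ `[0, t] `[0, 1]).
      by move=> s /=; rewrite !in_itv/=; exact: in01.
    by move=> s; apply: cvgM; [exact: cvg_cst|exact: cF].
  - by move=> s st; have [] := h_derive (in01 _ st) (Pt _ st).
  - move=> s st; apply: (@is_deriveZ _ _ _ F C s 1 (speed j c s)).
    by apply: dF; lra.
  - by move=> s /io01 st; have [] := h_derive (in01 _ st) (Pt _ st).
have all_P t : 0 <= t <= 1 -> P t.
  apply: real_induction => {}t t01 Ps.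
  have P_t : P t.
    have [t0|t0] := eqVneq t 0.
      rewrite t0; split => //; apply: le_lt_trans short.
      by rewrite lerDl; exact: mulr_ge0 (ltW C0) (chart_length_ge0 _ _).
    pose r1 := `|h 0 - u0| + C * chart_length j c.
    have r1r : r1 < r := short.
    (* Before t the curve is in W, which is closed and contained in the ball. *)
    pose W := param i @` [set u | `|u - u0| <= r1].
    have : W (x t).
      apply: (closed_param_ball (ltW r1r)) => B /(x_continuous t01).
      move=> /nbhs_ballP[e /= e0 eB].
      have tp : 0 < t by rewrite lt_neqAle eq_sym t0; case/andP: t01.
      pose s := Num.max (t / 2) (t - e / 2).
      have sE : [/\ t / 2 <= s, t - e / 2 <= s & s < t].
        by rewrite !le_max !lexx orbT gt_max; split => //; apply/andP; split; lra.
      case: sE => s1 s2 s3; exists (x s); split; last first.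
        by apply: eB; rewrite /ball/= ger0_norm ?subr_ge0 ?(ltW s3)//; lra.
      have s01 : 0 <= s <= 1 by lra.
      have [ixs _] : P s by apply: Ps; lra.
      exists (h s); last by rewrite /h chartK.
      have : `|h s - h 0| <= C * F s by apply: est => // q hq; apply: Ps; lra.
      have := ler_distD (h 0) (h s) u0; have := Fle s s01.
      rewrite /r1 /= -F1 => k1 k2 k3.
      have : C * F s <= C * F 1 by rewrite ler_pM2l.
      by lra.
    move=> [u /= ur ux]; have [dx ex] := param_img (ball_img (le_trans ur (ltW r1r))).
    by rewrite /P /h -ux ex; split => //; apply: le_lt_trans r1r.
  split => //.
  have [ixt hr] := P_t.
  have n1 : \forall s \near t, dom i (x s).
    by apply: (x_continuous t01); apply: open_nbhs_nbhs; split => //; exact: dom_open.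
  have ch : {for t, continuous h}.
    apply: (@continuous_comp _ _ _ x (chart i)); first exact: x_continuous.
    exact: chart_continuous_at.
  have n2 : \forall s \near t, `|h s - u0| < r.
    have e0 : 0 < r - `|h t - u0| by rewrite subr_gt0.
    move/cvgrPdist_lt: ch => /(_ _ e0); apply: filterS => s.
    have := ler_distD (h t) (h s) u0; rewrite (distrC (h s) (h t)).
    by move: (`|h s - u0|) (`|h t - h s|) (`|h t - u0|) => a b d; lra.
  have n12 : nbhs t P by apply: filterI n1 n2.
  have [d /= d0 hd] := (nbhs_ballP t P).1 n12.
  exists d => // s s01 /andP[ts st]; apply: hd.
  by rewrite /ball/= distrC ger0_norm ?subr_ge0//; lra.
have o01 : 0 <= (1 : R) <= 1 by lra.
split; first by have [] := all_P 1 o01.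
rewrite -F1; apply: est => // s; exact: all_P.
Qed.

End Piece.

(** Induction on the pieces of the curve; what is left of the allowed length
    decreases by the length of each piece. *)
Lemma curve_chart_bound x y l : curve_length S x y l -> dom i x ->
  `|chart i x - u0| + C * l < r ->
  dom i y /\ `|chart i y - chart i x| <= C * l.
Proof.
elim=> {x y l} [x|j c y l hc jc hl IH] ix.
  by rewrite subrr normr0 mulr0.
have l0 := curve_length_ge0 hl.
rewrite mulrDr => short.
have [||ix1 h1] := chart_piece_bound hc jc => //.
  by apply: le_lt_trans short; rewrite lerD2l lerDl; exact: mulr_ge0 (ltW C0) l0.
have [|iy h2] := IH ix1.
  have := ler_distD (chart i (param j (c 0))) (chart i (param j (c 1))) u0.
  by lra.
split => //.
have := ler_distD (chart i (param j (c 1))) (chart i y) (chart i (param j (c 0))).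
by lra.
Qed.

End ChartDistance.

(** * Bi-Lipschitz charts and packing *)

Section LocalChart.
Variables (R : realType) (n : nat) (M : metricType R).
Variable (S : riemannian_structure R n M).
Hypothesis hdist : is_riemannian_distance S.
Local Notation img i := (chart (r := S) i @` dom i).

Lemma segment_C1 (w v : 'rV[R]_n) : C1_curve (fun t => w + t *: v) /\
  derive1 (fun t : R => w + t *: v) = cst v.
Proof.
have d (t : R) : is_diff t (fun t : R => w + t *: v) (fun t => t *: v).
  have := @is_diffD _ _ _ _ _ _ _ t (is_diff_cst w t) (is_diff_scalel t v).
  by rewrite add0r.
have e : derive1 (fun t : R => w + t *: v) = cst v.
  apply/funext => t; rewrite derive1E'; last by have [] := d t.
  by have [_ ->] := d t; rewrite scale1r.
split; last exact: e.
split; last by rewrite e; exact: cst_continuous.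
by move=> t; apply/derivable1_diffP; have [] := d t.
Qed.

(** The length of the segment in coordinates bounds the distance. *)
Lemma mdist_le_chart i u0 r C (a b : M) : dom i a -> dom i b ->
  [set u | `|u - u0| <= r] `<=` img i ->
  (forall u v, `|u - u0| <= r ->
     Num.sqrt (bilin (rmetric i u) v v) <= C * `|v|) ->
  `|chart i a - u0| <= r -> `|chart i b - u0| <= r ->
  mdist a b <= C * `|chart i a - chart i b|.
Proof.
move=> ia ib sub hC ar br.
set wa := chart i a in ar *; set wb := chart i b in br *.
have [hc dc] := segment_C1 wa (wb - wa).
have near_u0 (t : R) : 0 <= t <= 1 -> `|wa + t *: (wb - wa) - u0| <= r.
  move=> /andP[t0 t1].
  have -> : wa + t *: (wb - wa) - u0 = (1 - t) *: (wa - u0) + t *: (wb - u0).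
    by apply/rowP => k; rewrite !mxE; ring.
  apply: le_trans (ler_normD _ _) _; rewrite !normrZ !ger0_norm ?subr_ge0//.
  have -> : r = (1 - t) * r + t * r by ring.
  by apply: lerD; apply: ler_wpM2l; rewrite ?subr_ge0.
have ic : in_chart i (fun t => wa + t *: (wb - wa)).
  by move=> t t01; apply: sub; exact: near_u0.
have [F [F0 F1 cF dF FL]] := piece_length_function hc ic.
have := mdist_le_length hdist (FL 0 1 (lexx _) ler01 (lexx _)).
rewrite scale0r addr0 scale1r subrKC !chartK// => h; apply: le_trans h _.
rewrite (distrC wa wb); set v := wb - wa in dF hc dc *.
have cG : {within `[0, 1], continuous (fun t : R => C * `|v| * t)}.
  apply: continuous_subspaceT => t; apply: cvgM; [exact: cvg_cst|].
  by move=> A.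
have dG (t : R) : 0 < t < 1 -> is_derive t 1 (fun t : R => C * `|v| * t) (C * `|v|).
  by move=> _; apply: is_derive_eq; rewrite /GRing.scale/= mulr1.
have := @derive_dist_le _ F _ _ _ 0 1 ler01 cF cG dF dG.
rewrite mulr1 mulr0 subr0 => h; apply: le_trans (ler_norm _) _; apply: h.
move=> t /andP[t0 t1]; rewrite ger0_norm ?speed_ge0// /speed dc.
by apply: hC; apply: near_u0; rewrite !ltW.
Qed.

(** Balls of small radius are contained in a compact set, and on them the
    coordinates of a chart are bi-Lipschitz. *)
Lemma local_chart (p : M) : exists (phi : M -> 'rV[R]_n) (K : set M) (r C : R),
  [/\ 0 < r, 0 < C, compact K,
    forall z, mdist p z < r -> K z /\ `|phi z - phi p| <= C * mdist p z &
    forall a b, mdist p a < r -> mdist p b < r ->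
      mdist a b <= C * `|phi a - phi b|].
Proof.
have [i ip] := dom_cover S p.
have : nbhs (chart i p) (img i).
  by apply: open_nbhs_nbhs; split; [exact: chart_open|exists p].
move=> /nbhs_ballP[e /= e0 he]; pose r0 := e / 2.
have r0p : 0 < r0 by rewrite divr_gt0.
have sub : [set u | `|u - chart i p| <= r0] `<=` img i.
  move=> u /= h; apply: he; rewrite -ball_normE /ball_/= distrC.
  by apply: le_lt_trans h _; rewrite /r0; lra.
have [C C0 hC] := rmetric_bounds sub (ltW r0p).
have low u v : `|u - chart i p| <= r0 ->
    `|v| <= C * Num.sqrt (bilin (rmetric i u) v v) by move=> /hC h; have [] := h v.
have up u v : `|u - chart i p| <= r0 ->
    Num.sqrt (bilin (rmetric i u) v v) <= C * `|v| by move=> /hC h; have [] := h v.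
have main z : mdist p z < r0 / C ->
    dom i z /\ `|chart i z - chart i p| <= C * mdist p z.
  move=> pz.
  have hz (d : R) : 0 < d -> mdist p z + d <= r0 / C ->
      dom i z /\ `|chart i z - chart i p| <= C * (mdist p z + d).
    move=> d0 dr; have [l hl ld] := short_curve_exists hdist p z d0.
    have Cl : C * l <= C * (mdist p z + d) by rewrite ler_pM2l// ltW.
    have [|iz h] := curve_chart_bound sub C0 low hl ip.
      rewrite subrr normr0 add0r mulrC -ltr_pdivlMr//.
      exact: lt_le_trans dr.
    by split => //; apply: le_trans Cl.
  split.
    have [| |//] := hz (r0 / C - mdist p z); first by rewrite subr_gt0.
    by rewrite subrKC.
  apply/ler_addgt0Pl => d d0.
  pose d' := Num.min (d / C) (r0 / C - mdist p z).
  have d'0 : 0 < d' by rewrite lt_min subr_gt0 pz divr_gt0.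
  have d1 : d' <= d / C by rewrite ge_min lexx.
  have d2 : d' <= r0 / C - mdist p z by rewrite ge_min lexx orbT.
  have [|_ h] := hz d' d'0; first by lra.
  apply: le_trans h _; rewrite mulrDr addrC lerD2r.
  by rewrite mulrC -ler_pdivlMr.
exists (chart i), (param i @` [set u | `|u - chart i p| <= r0]), (r0 / C), C.
split => //.
- by rewrite divr_gt0.
- apply: continuous_compact; last exact: compact_norm_ball.
  exact: continuous_subspaceW sub (@param_continuous _ _ _ S i).
- move=> z pz; have [iz h] := main z pz; split => //.
  exists (chart i z); last exact: chartK.
  by apply: le_trans h _; rewrite mulrC -ler_pdivlMr// ltW.
- move=> a b pa pb; have [ia ha] := main a pa; have [ib hb] := main b pb.
  apply: (mdist_le_chart ia ib sub up).
    by apply: le_trans ha _; rewrite mulrC -ler_pdivlMr// ltW.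
  by apply: le_trans hb _; rewrite mulrC -ler_pdivlMr// ltW.
Qed.

(** Finite dimension: the coordinates of the points lie in a cube of side
    2 C rho, cut into a number of cells that does not depend on rho, and two points
    in the same cell are at distance less than rho / 8. *)
Lemma packing_bound (p : M) : exists (N : nat) (r : R), 0 < r /\
  forall rho : R, 0 < rho < r -> forall a : 'I_N -> M,
    (forall k, mdist p (a k) <= rho) ->
    exists j k : 'I_N, (j < k)%N /\ mdist (a j) (a k) < rho / 8.
Proof.
have [phi [K [r [C [r0 C0 _ h1 h2]]]]] := local_chart p.
pose m := (Num.truncn (32 * C ^+ 2)).+1.
exists (m ^ n).+1, r; split => // rho /andP[rho0 rhor] a pa.
have par k : mdist p (a k) < r by exact: le_lt_trans (pa k) rhor.
(* Coordinates rescaled so that the cells have side rho / (16 C). *)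
pose y k (q : 'I_n) : R := ((phi (a k) - phi p) 0 q + C * rho) * (16 * C / rho).
have y_bound k q : 0 <= y k q < m%:R.
  have [_ hk] := h1 _ (par k).
  have := le_trans (norm_entry_le (phi (a k) - phi p) q) hk.
  have : C * mdist p (a k) <= C * rho by rewrite ler_pM2l.
  rewrite /y; set w := (phi (a k) - phi p) 0 q => e1 e2.
  have : `|w| <= C * rho by lra.
  rewrite ler_norml => /andP[w1 w2].
  have Cr : 0 < 16 * C / rho by rewrite divr_gt0// mulr_gt0.
  rewrite mulr_ge0 ?(ltW Cr)//=; last by lra.
  have b0 : 0 <= 32 * C ^+ 2 by rewrite mulr_ge0// sqr_ge0.
  have /andP[_ b1] := truncn_itv b0.
  apply: le_lt_trans b1.
  have -> : 32 * C ^+ 2 = (2 * C * rho) * (16 * C / rho).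
    by field; rewrite gt_eqF.
  by rewrite ler_wpM2r// ?(ltW Cr)//; lra.
have cell_lt k q : (Num.truncn (y k q) < m)%N.
  have /andP[y0 ym] := y_bound k q; have /andP[y1 _] := truncn_itv y0.
  by rewrite -(ltr_nat R) (le_lt_trans y1).
pose cell k : {ffun 'I_n -> 'I_m} := [ffun q => Ordinal (cell_lt k q)].
have [j [k [jk e]]] : exists j k : 'I_(m ^ n).+1, (j < k)%N /\ cell j = cell k.
  apply: contrapT => ninj.
  have /leq_card : injective cell.
    move=> j k e; apply: contrapT => jk; apply: ninj.
    have [lt|lt|/val_inj//] := ltngtP j k; first by exists j, k.
    by exists k, j.
  by rewrite card_ffun !card_ord ltnn.
exists j, k; split => //.
apply: le_lt_trans (h2 _ _ (par j) (par k)) _.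
have : `|phi (a j) - phi (a k)| <= rho / (16 * C).
  apply: norm_le_entries => [|q]; first by rewrite divr_ge0 ?mulr_ge0// ltW.
  have : val (cell j q) = val (cell k q) by rewrite e.
  rewrite !ffunE /= => eq_cell.
  have /andP[yj _] := y_bound j q; have /andP[yk _] := y_bound k q.
  have /andP[j1 j2] := truncn_itv yj; have /andP[k1 k2] := truncn_itv yk.
  rewrite -eq_cell -natr1 in k1 k2; rewrite -natr1 in j2.
  have d1 : `|y j q - y k q| <= 1 by rewrite ler_norml; lra.
  have -> : (phi (a j) - phi (a k)) 0 q = (y j q - y k q) * (rho / (16 * C)).
    by rewrite /y !mxE; field; rewrite !gt_eqF.
  have c0 : 0 < rho / (16 * C) by rewrite divr_gt0// mulr_gt0.
  by rewrite normrM (ger0_norm (ltW c0)) ler_piMl// ltW.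
move=> h; apply: (@le_lt_trans _ _ (C * (rho / (16 * C)))).
  by rewrite ler_pM2l.
rewrite (_ : C * (rho / (16 * C)) = rho / 16); first by lra.
by field; rewrite gt_eqF.
Qed.

End LocalChart.

(** * Geodesics and submetries *)

Section Geodesic.
Variables (R : realType) (M : metricType R) (U : set M).

Lemma geodesic_left (x y : M) f (t : R) : geodesic U x y f -> 0 <= t <= 1 ->
  mdist x (f t) = t * mdist x y.
Proof.
move=> [f0 f1 _ fd] t01; rewrite -{1}f0 fd//; last by lra.
by rewrite sub0r normrN ger0_norm//; lra.
Qed.

Lemma geodesic_right (x y : M) f (t : R) : geodesic U x y f -> 0 <= t <= 1 ->
  mdist (f t) y = (1 - t) * mdist x y.
Proof.
move=> [f0 f1 _ fd] t01; rewrite -{1}f1 fd//; last by lra.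
by rewrite distrC ger0_norm//; lra.
Qed.

Lemma geodesic_initial (x y : M) f (t : R) : geodesic U x y f -> 0 <= t <= 1 ->
  geodesic U x (f t) (fun s => f (t * s)).
Proof.
move=> g t01; have [f0 f1 fU fd] := g.
have in01 (s : R) : 0 <= s <= 1 -> 0 <= t * s <= 1.
  by move: t01 => /andP[? ?] /andP[? ?]; apply/andP; split; nra.
split; first by rewrite mulr0.
- by rewrite mulr1.
- by move=> s /in01; exact: fU.
- move=> s s' hs hs'; rewrite fd ?in01// (geodesic_left g)// -mulrBr normrM.
  by rewrite (ger0_norm (_ : 0 <= t)); [ring|case/andP: t01].
Qed.

End Geodesic.

Section Submetry.
Variables (R : realType) (X Y : metricType R) (P : X -> Y).
Hypothesis hP : submetry P.

Lemma submetry_lipschitz u v : mdist (P u) (P v) <= mdist u v.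
Proof.
apply/ler_addgt0Pl => e e0; have r0 : 0 < e + mdist u v.
  by rewrite ltr_wpDr// mdist_ge0.
have : (P @` ball u (e + mdist u v)) (P v).
  by exists v => //; rewrite ballEmdist/= ltrDr.
by rewrite hP// ballEmdist/=; exact: ltW.
Qed.

Lemma submetry_continuous : continuous P.
Proof.
move=> u; apply/cvg_ballP => e e0; near=> v.
have : ball u e v by near: v; exact: nbhsx_ballx.
rewrite !ballEmdist/=; exact: le_lt_trans (submetry_lipschitz u v).
Unshelve. all: by end_near. Qed.

Lemma closed_fiber z : closed (P @^-1` [set z]).
Proof.
apply: preimage_closed; first by move=> x _; exact: submetry_continuous.
exact: accessible_closed_set1 (hausdorff_accessible (@metric_hausdorff _ _)) z.
Qed.

(** The defining property gives preimages of z at distances from u arbitrarily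
    close to d (P u, z); by compactness, the infimum is attained. *)
Lemma submetry_lift (K : set X) u z e : compact K -> 0 < e ->
  (forall v, mdist u v < mdist (P u) z + e -> K v) ->
  exists2 v, P v = z & mdist u v = mdist (P u) z.
Proof.
move=> cK e0 uK; set d := mdist (P u) z in uK *.
have near_z e' : 0 < e' -> exists2 v, P v = z & mdist u v < d + e'.
  move=> e'0; have r0 : 0 < d + e' by rewrite ltr_wpDl// mdist_ge0.
  have : ball (P u) (d + e') z by rewrite ballEmdist/= ltrDl.
  rewrite -hP// => -[v uv Pv]; exists v => //.
  by move: uv; rewrite ballEmdist.
have cLK : compact (K `&` P @^-1` [set z]).
  by apply: compact_closedI => //; exact: closed_fiber.
have [|q [Kq Pq] hq] := compact_dist_min u cLK.
  by have [v Pv uv] := near_z e e0; exists v; split => //; exact: uK.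
exists q => //; apply/le_anti/andP; split; last first.
  by rewrite /d -Pq; exact: submetry_lipschitz.
apply/ler_addgt0Pl => e1 e10; rewrite addrC.
pose e' := Num.min e e1; have e'0 : 0 < e' by rewrite lt_min e0.
have [v Pv uv] := near_z e' e'0.
have h1 : e' <= e by rewrite ge_min lexx.
have h2 : e' <= e1 by rewrite ge_min lexx orbT.
have : mdist u q <= mdist u v.
  by apply: hq; split => //; apply: uK; apply: lt_le_trans uv _; rewrite lerD2l.
by lra.
Qed.

End Submetry.

(** * Comparison near a point *)

Section LocalComparison.
Variables (R : realType) (n : nat) (M : metricType R).
Variable (S : riemannian_structure R n M).
Hypothesis hdist : is_riemannian_distance S.
Variables (p : M) (U K : set M) (k k' s : R).
Hypotheses (s0 : 0 < s) (cK : compact K).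
Hypothesis near_p : forall z, mdist p z < 3 * s -> K z /\ U z.
Hypotheses (hk : model_radius k (8 * s)) (hk' : model_radius k' (8 * s)).
Hypotheses (Uge : curvature_ge k U) (Ule : curvature_le k' U).

Lemma mdist_lt2 a b : mdist p a < s -> mdist p b < s -> mdist a b < 2 * s.
Proof. by move=> pa pb; have := dist_triangle a p b; rewrite (dist_sym a p); lra. Qed.

Lemma local_geodesic a b : mdist p a < s -> mdist p b < s ->
  exists f, geodesic U a b f.
Proof.
move=> pa pb; have ab := mdist_lt2 pa pb.
have in3 z : mdist a z <= mdist a b -> mdist p z < 3 * s.
  by move=> az; have := dist_triangle p a z; lra.
have [|f hf] := geodesic_exists hdist cK (x := a) (y := b).
  by move=> z /in3 /near_p[].
exists f; have [f0 f1 _ fd] := hf; split => // t t01.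
have [] // := near_p (z := f t); apply: in3; rewrite (geodesic_left hf)//.
by rewrite ler_piMl ?mdist_ge0//; case/andP: t01.
Qed.

(** All vertices are within s of p, so the sides exist and are contained in U, and
    the perimeter is small enough for comparison. *)
Lemma local_hinge c cmp a x y f : model_radius c (8 * s) ->
  triangle_comparison c U cmp ->
  mdist p a < s -> mdist p x < s -> mdist p y < s -> geodesic U x y f ->
  0 < mdist a x -> 0 < mdist x y ->
  exists t, [/\ -1 <= t <= 1,
    chord2 c (mdist a y) = cosine_law c (mdist a x) (mdist x y) t &
    forall l, 0 <= l <= 1 -> mdist a (f l) <= 8 * s /\
      exists d, [/\ 0 <= d <= 8 * s,
      chord2 c d = cosine_law c (mdist a x) (l * mdist x y) t &
      cmp (mdist a (f l)) d]].
Proof.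
move=> hc hcmp pa px py gf ax xy.
have [g gg] := local_geodesic pa px; have [h gh] := local_geodesic py pa.
have ax2 := mdist_lt2 pa px; have xy2 := mdist_lt2 px py.
have [|t [t1 e H]] := hinge hc hcmp gg gf gh ax xy; first by lra.
exists t; split => // l l01; split; last exact: H.
have := dist_triangle a x (f l); rewrite (geodesic_left gf l01).
have : l * mdist x y <= mdist x y by rewrite ler_piMl ?mdist_ge0//; case/andP: l01.
by have := s0; lra.
Qed.

Lemma lower_hinge a x y f :
  mdist p a < s -> mdist p x < s -> mdist p y < s -> geodesic U x y f ->
  0 < mdist a x -> 0 < mdist x y ->
  exists t, [/\ -1 <= t <= 1,
    chord2 k (mdist a y) = cosine_law k (mdist a x) (mdist x y) t &
    forall l, 0 <= l <= 1 ->
      cosine_law k (mdist a x) (l * mdist x y) t <= chord2 k (mdist a (f l))].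
Proof.
move=> pa px py gf ax xy.
have [t [t1 e H]] := local_hinge hk Uge pa px py gf ax xy.
exists t; split => // l l01; have [afl [d [/andP[d0 d1] <- hd]]] := H l l01.
exact: chord2_le hk d0 hd afl.
Qed.

Lemma upper_hinge a x y f :
  mdist p a < s -> mdist p x < s -> mdist p y < s -> geodesic U x y f ->
  0 < mdist a x -> 0 < mdist x y ->
  exists t, [/\ -1 <= t <= 1,
    chord2 k' (mdist a y) = cosine_law k' (mdist a x) (mdist x y) t &
    forall l, 0 <= l <= 1 ->
      chord2 k' (mdist a (f l)) <= cosine_law k' (mdist a x) (l * mdist x y) t].
Proof.
move=> pa px py gf ax xy.
have [t [t1 e H]] := local_hinge hk' Ule pa px py gf ax xy.
exists t; split => // l l01; have [afl [d [/andP[d0 d1] <- hd]]] := H l l01.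
by apply: (chord2_le hk') => //; exact: mdist_ge0.
Qed.

(** Angles at p increase when the sides shrink.  The ratio chord2 |ab| / sn^2 is
    2 (1 - t) for the cosine t of the comparison angle of the isosceles triangle
    p a b.  Shrinking first the side to a, then the side to b, can only decrease
    the cosine. *)
Lemma shrink_chord2 a b f g (t l : R) : mdist p a = t -> mdist p b = t ->
  0 < t < s -> 0 < l <= 1 -> geodesic U p a f -> geodesic U p b g ->
  chord2 k (mdist a b) * sn k (l * t) ^+ 2 <=
  chord2 k (mdist (f l) (g l)) * sn k t ^+ 2.
Proof.
move=> pa pb /andP[t0 ts] /andP[l0 l1] gf gg.
have l01 : 0 <= l <= 1 by rewrite ltW.
have lt0 : 0 < l * t by exact: mulr_gt0.
have ltt : l * t <= t by rewrite ler_piMl// ltW.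
have pps : mdist p p < s by rewrite mdistxx.
have pas : mdist p a < s by rewrite pa.
have pbs : mdist p b < s by rewrite pb.
have snt : 0 < sn k t by apply: (sn_gt0 hk); have := s0; lra.
have snl : 0 < sn k (l * t) by apply: (sn_gt0 hk); have := s0; lra.
have pfl : mdist p (f l) = l * t by rewrite (geodesic_left gf)// pa.
have pfls : mdist p (f l) < s by rewrite pfl; lra.
have [||x [_ ex hx]] := lower_hinge pbs pps pas gf; rewrite ?(dist_sym b p) ?pa ?pb//.
have [||x' [_ ex' hx']] := lower_hinge pfls pps pbs gg;
  rewrite ?(dist_sym (f l) p) ?pfl ?pb//.
rewrite (dist_sym b p) pa pb cosine_law_diag (dist_sym b a) in ex hx.
rewrite (dist_sym (f l) p) pfl pb in ex' hx'.
have x'x : x' <= x.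
  have := hx l l01; rewrite dist_sym ex' cosine_lawC /cosine_law.
  have : 0 < sn k (l * t) * sn k t by exact: mulr_gt0.
  set q := sn k (l * t) * sn k t => q0 h.
  rewrite -(ler_pM2l q0); lra.
have := hx' l l01; rewrite cosine_law_diag => h.
have w1 : 0 < sn k (l * t) ^+ 2 by exact: exprn_gt0.
have w2 : 0 < sn k t ^+ 2 by exact: exprn_gt0.
rewrite ex; set A := sn k t ^+ 2 in w2 *; set B := sn k (l * t) ^+ 2 in w1 h *.
apply: (@le_trans _ _ (2 * B * (1 - x') * A)); last by rewrite ler_pM2r.
have -> : 2 * A * (1 - x) * B = (2 * B * A) * (1 - x) by ring.
have -> : 2 * B * (1 - x') * A = (2 * B * A) * (1 - x') by ring.
by apply: ler_wpM2l; [rewrite !mulr_ge0// ltW|lra].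
Qed.

(** The bounds for [sn] and [chord2] cost a constant factor, which turns 1/2
    into 1/8. *)
Lemma shrink_mdist a b f g (t l : R) : mdist p a = t -> mdist p b = t ->
  0 < t < s -> 0 < l <= 1 -> geodesic U p a f -> geodesic U p b g ->
  t / 2 <= mdist a b -> l * t / 8 <= mdist (f l) (g l).
Proof.
move=> pa pb ts l01 gf gg ab.
have := shrink_chord2 pa pb ts l01 gf gg.
move: ts l01 => /andP[t0 ts] /andP[l0 l1].
have lt0 : 0 < l * t by exact: mulr_gt0.
have ltt : l * t <= t by rewrite ler_piMl// ltW.
have [_ _ hs] := hk.
have ab2 : mdist a b < 2 * s by apply: mdist_lt2; rewrite ?pa ?pb.
have fl : mdist p (f l) = l * t by rewrite (geodesic_left gf) ?pa//; lra.
have gl : mdist p (g l) = l * t by rewrite (geodesic_left gg) ?pb//; lra.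
have fg2 : mdist (f l) (g l) < 2 * s by apply: mdist_lt2; rewrite ?fl ?gl; lra.
have s0' := s0.
have /andP[v1 _] : mdist a b ^+ 2 / 2 <= chord2 k (mdist a b) <= 2 * mdist a b ^+ 2.
  by apply: (chord2_bound hk); [exact: mdist_ge0|lra].
have D0 : 0 <= mdist (f l) (g l) := mdist_ge0 _ _.
have /andP[_ v2] := chord2_bound hk D0 (ltac:(lra) : mdist (f l) (g l) <= 8 * s).
have /andP[a1 _] := hs (l * t) (ltac:(lra)).
have /andP[b0 b1] := hs t (ltac:(lra)).
move: D0 v1 v2 a1 b0 b1.
set D := mdist (f l) (g l); set V := chord2 k (mdist a b); set W := chord2 k D.
set q := sn k (l * t); set q' := sn k t; set u := l * t in lt0 *.
move=> D0 v1 v2 a1 b0 b1 H.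
have e1 : t ^+ 2 / 8 <= V.
  have : (t / 2) ^+ 2 <= mdist a b ^+ 2 by rewrite ler_sqr ?nnegrE ?mdist_ge0//; lra.
  by lra.
have e2 : (3 / 4 * u) ^+ 2 <= q ^+ 2 by rewrite ler_sqr ?nnegrE; lra.
have e3 : q' ^+ 2 <= (4 / 3 * t) ^+ 2 by rewrite ler_sqr ?nnegrE; lra.
have lhs : (t ^+ 2 / 8) * (3 / 4 * u) ^+ 2 <= V * q ^+ 2.
  by apply: ler_pM => //; rewrite ?sqr_ge0// divr_ge0// sqr_ge0.
have rhs : W * q' ^+ 2 <= (2 * D ^+ 2) * (4 / 3 * t) ^+ 2.
  apply: ler_pM => //; rewrite ?sqr_ge0//.
  by apply: mulr_ge0 => //; exact: sqr_ge0.
have : t ^+ 2 * (u / 8) ^+ 2 <= t ^+ 2 * D ^+ 2.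
  have : 0 <= t ^+ 2 * u ^+ 2 by rewrite mulr_ge0 ?sqr_ge0.
  by lra.
rewrite ler_pM2l ?exprn_gt0// ler_sqr ?nnegrE//.
by rewrite divr_ge0// ltW.
Qed.

End LocalComparison.

(** * Fibers near a point *)

Lemma positive_lower_bound (R : realType) (T : eqType) (f : T -> R) (s : seq T) (b : R) :
  0 < b -> (forall x, x \in s -> 0 < f x) ->
  exists2 e, 0 < e <= b & forall x, x \in s -> e <= f x.
Proof.
move=> b0; elim: s => [|x s IH] fs; first by exists b; rewrite ?b0 ?lexx.
have [|e /andP[e0 eb] he] := IH.
  by move=> z zs; apply: fs; rewrite inE zs orbT.
exists (Num.min e (f x)).
  by rewrite lt_min e0 fs ?mem_head//= ge_min eb.
move=> z; rewrite inE => /predU1P[->|/he]; first by rewrite ge_min lexx orbT.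
by rewrite ge_min => ->.
Qed.

Section LocalFiber.
Variables (R : realType) (n : nat) (M : metricType R).
Variable (S : riemannian_structure R n M).
Hypothesis hdist : is_riemannian_distance S.
Variables (p : M) (U K : set M) (k k' s : R).
Hypotheses (s0 : 0 < s) (cK : compact K).
Hypothesis near_p : forall z, mdist p z < 3 * s -> K z /\ U z.
Hypotheses (hk : model_radius k (8 * s)) (hk' : model_radius k' (8 * s)).
Hypotheses (Uge : curvature_ge k U) (Ule : curvature_le k' U).
Variables (Y : metricType R) (P : M -> Y).
Hypothesis hP : submetry P.

(** The sum of the two distances bounds the distance from p to the lifts, which
    stay in the compact set K. *)
Lemma local_lift u z : mdist p u + mdist (P u) z < 3 * s ->
  exists2 v, P v = z & mdist u v = mdist (P u) z.
Proof.
move=> h; apply: (@submetry_lift _ _ _ _ hP K u z (3 * s - (mdist p u + mdist (P u) z))) => //.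
  by rewrite subr_gt0.
move=> v uv; have [] // := near_p (z := v).
by have := dist_triangle p u v; lra.
Qed.

(** The point w is closer to P p than z, but going from P p to w gains less
    than half of d (w, P p) in the direction of z: the comparison angle at P p
    is not small. *)
Definition far_apart (w z : Y) : bool :=
  (mdist w (P p) < mdist z (P p)) &&
  (mdist z (P p) - mdist w (P p) / 2 < mdist z w).

(** Lift the points z to points q with |pq| = d (P p, z), and let t be the
    smaller one of two such distances.  The point at distance t on the longer
    of the two geodesics is, by the triangle inequality, at distance at least
    t / 2 from the end of the shorter one.  Shrinking to a common distance rho
    yields points whose number is bounded by the packing bound. *)
Lemma far_apart_bounded : exists N : nat, forall zs : seq Y, size zs = N ->
  (forall z, z \in zs -> 0 < mdist z (P p) < s / 2) -> ~~ pairwise far_apart zs.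
Proof.
have [N [r [r0 hN]]] := packing_bound hdist p.
exists N => zs szs hz; apply/negP => /(pairwiseP (P p)) hpw.
have r20 : 0 < r / 2 by rewrite divr_gt0.
have [|rho /andP[rho0 rhor] hrho] :=
  @positive_lower_bound _ _ (fun z => mdist z (P p)) zs (r / 2) r20.
  by move=> z /hz /andP[].
pose z (i : 'I_N) := nth (P p) zs i; pose t i := mdist (z i) (P p).
have zin i : z i \in zs by apply: mem_nth; rewrite szs.
have t_s i : 0 < t i < s / 2 by apply: hz.
have t_rho i : rho <= t i by apply: hrho.
have ray (i : 'I_N) : exists qf : M * (R -> M), [/\ P qf.1 = z i,
    mdist p qf.1 = t i & geodesic U p qf.1 qf.2].
  have s0' := s0; have ts := t_s i.
  have [|q Pq pq] := @local_lift p (z i).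
    by rewrite mdistxx add0r dist_sym -/(t i); lra.
  have pq' : mdist p q = t i by rewrite pq dist_sym.
  have [||f gf] := local_geodesic hdist cK near_p (a := p) (b := q).
  - by rewrite mdistxx.
  - by rewrite pq'; lra.
  by exists (q, f).
have [qf hqf] := choice ray.
have l01 i : 0 < rho / t i <= 1.
  have /andP[ti _] := t_s i.
  by rewrite divr_gt0//= ler_pdivrMr ?mul1r.
have [||j [i [ji]]] := hN rho _ (fun i => (qf i).2 (rho / t i)).
- by rewrite rho0/=; lra.
- move=> i; have [Pq pq gf] := hqf i; have /andP[ti _] := t_s i.
  rewrite (geodesic_left gf).
    by rewrite pq divfK// gt_eqF.
  by have := l01 i; lra.
apply/negP; rewrite -leNgt.
have [Pi pi gi] := hqf i; have [Pj pj gj] := hqf j.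
have /andP[ti1 ti2] := t_s i; have /andP[tj1 tj2] := t_s j.
have /andP[tij far] : far_apart (z j) (z i).
  by apply: hpw; rewrite ?inE ?szs.
rewrite -/(t i) -/(t j) in tij far.
have lji : 0 <= t j / t i <= 1.
  rewrite divr_ge0 ?(ltW tj1) ?(ltW ti1)//= ler_pdivrMr// mul1r; exact: ltW.
(* The point on the longer geodesic at the distance t j of the shorter one. *)
pose c := (qf i).2 (t j / t i).
have pc : mdist p c = t j by rewrite (geodesic_left gi)// pi divfK// gt_eqF.
have cq : mdist c (qf i).1 = t i - t j.
  by rewrite (geodesic_right gi)// pi mulrBl mul1r divfK// gt_eqF.
have cj : t j / 2 <= mdist c (qf j).1.
  have := submetry_lipschitz hP (qf i).1 (qf j).1; rewrite Pi Pj.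
  have := dist_triangle (qf i).1 c (qf j).1; rewrite (dist_sym _ c) cq.
  by lra.
have s0' := s0.
have := shrink_mdist hdist s0 cK near_p hk Uge pc pj _ (l01 j)
  (geodesic_initial gi lji) gj cj.
rewrite (_ : t j / t i * (rho / t j) = rho / t i); last first.
  by field; rewrite !gt_eqF.
rewrite divfK ?gt_eqF// dist_sym; apply.
by rewrite tj1/=; lra.
Qed.

(** Replaces the compactness of the space of directions at P p: a finite set of
    points w at a definite distance sees every direction at P p.  Otherwise, the
    point z that is bad for the points chosen so far can be added to them for
    ever. *)
Lemma finite_directions : exists (ws : seq Y) (d : R),
  [/\ 0 < d, forall w, w \in ws -> 0 < mdist w (P p) < s / 2 &
   forall z, 0 < mdist z (P p) < d -> exists2 w, w \in ws &
     mdist w z <= mdist w (P p) - mdist z (P p) / 2].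
Proof.
have [N hN] := far_apart_bounded.
apply: contrapT => nH.
have build m : exists zs : seq Y, [/\ size zs = m,
    forall z, z \in zs -> 0 < mdist z (P p) < s / 2 & pairwise far_apart zs].
  elim: m => [|m [zs [sz hz pz]]]; first by exists [::].
  have s20 : 0 < s / 2 by rewrite divr_gt0.
  have [|e /andP[e0 es] he] :=
    @positive_lower_bound _ _ (fun z => mdist z (P p)) zs (s / 2) s20.
    by move=> z /hz /andP[].
  have [z [/andP[z0 ze] hfar]] : exists z, 0 < mdist z (P p) < e /\
      forall w, w \in zs -> mdist w (P p) - mdist z (P p) / 2 < mdist w z.
    apply: contrapT => nz; apply: nH; exists zs, e; split => // z hze.
    apply: contrapT => nw; apply: nz; exists z; split => // w wzs.
    by rewrite ltNge; apply/negP => h; apply: nw; exists w.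
  exists (z :: zs); split; first by rewrite /= sz.
    move=> w; rewrite inE => /predU1P[->|/hz//].
    by rewrite z0 (lt_le_trans ze).
  rewrite pairwise_cons pz andbT; apply/allP => w wzs.
  by rewrite /far_apart (lt_le_trans ze (he w wzs)) hfar.
have [zs [sz hz pz]] := build N.
by have := hN zs sz hz; rewrite pz.
Qed.

(** Write m for the midpoint of ab and W for d (w, P p), with w given by
    [finite_directions] for the direction of P m.  The point q of the fiber of w
    closest to m satisfies |qm| = d (w, P m) <= W - d (P m, P p) / 2, but
    |qa|, |qb| >= W.  The median formula in curvature >= k then bounds
    d (P m, P p) by a multiple of |ab|^2 / W. *)
Lemma fiber_almost_convex : exists C eta : R, [/\ 0 < C, 0 < eta, eta <= s / 8 &
  forall a b f, P a = P p -> P b = P p -> mdist p a < eta -> mdist p b < eta ->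
    geodesic U a b f -> mdist (P (f (1 / 2))) (P p) <= C * mdist a b ^+ 2].
Proof.
have [ws [d [d0 hws hd]]] := finite_directions.
have [|D /andP[D0 _] hD] :=
  @positive_lower_bound _ _ (fun z => mdist z (P p)) ws 1 ltr01.
  by move=> w /hws /andP[].
pose B := 1 + `|k| * s ^+ 2.
have B0 : 0 < B by rewrite ltr_wpDr// mulr_ge0// sqr_ge0.
have s0' := s0.
exists (2 * B / D), (Num.min d (s / 8)); split.
- by rewrite divr_gt0// mulr_gt0.
- by rewrite lt_min d0; lra.
- by rewrite ge_min lexx orbT.
move=> a b f Pa Pb; rewrite !lt_min => /andP[pad pas] /andP[pbd pbs] gf.
set m := f (1 / 2); set t := mdist (P m) (P p).
have half01 : 0 <= (1 / 2 : R) <= 1 by lra.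
have ab := dist_triangle a p b; rewrite (dist_sym a p) in ab.
have am : mdist a m = 1 / 2 * mdist a b := geodesic_left gf half01.
have t_le : t <= 1 / 2 * mdist a b.
  by rewrite -am /t dist_sym -Pa; exact: submetry_lipschitz.
have t0 : 0 <= t := mdist_ge0 _ _.
(* Directions are defined only if P m differs from P p. *)
have [tz|tn0] := eqVneq t 0.
  by rewrite tz; apply: mulr_ge0; [rewrite ltW// divr_gt0// mulr_gt0|exact: sqr_ge0].
have tp : 0 < t by rewrite lt_neqAle eq_sym tn0.
have [|w wws wm] := hd (P m); first by rewrite -/t tp; lra.
have /andP[wp ws2] := hws w wws; rewrite -/t in wm.
have pm := dist_triangle p a m.
have [|q Pq mq] := @local_lift m w; first by rewrite (dist_sym (P m)); lra.
rewrite (dist_sym (P m)) in mq.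
have pq : mdist p q < s by have := dist_triangle p m q; lra.
have pas' : mdist p a < s by lra.
have pbs' : mdist p b < s by lra.
have qx x : P x = P p -> mdist w (P p) <= mdist q x.
  by move=> Px; rewrite -Pq -Px; exact: submetry_lipschitz.
have ab0 : 0 < mdist a b by lra.
have [|x [_ ex hx]] := lower_hinge hdist s0 cK near_p hk Uge pq pas' pbs' gf _ ab0.
  exact: lt_le_trans wp (qx a Pa).
have := hx (1 / 2) half01; rewrite -/m => {}hx.
set l := 1 / 2 * mdist a b in t_le hx am.
have lE : mdist a b = 2 * l by rewrite /l; field.
rewrite lE in ex ab0 ab *.
have l0 : 0 <= l by lra.
have cl : 0 <= cs k l by apply: (cs_ge0 hk); lra.
have main := median_ge cl ex hx.
have q2 z : P z = P p -> mdist p z < s ->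
    chord2 k (mdist w (P p)) <= chord2 k (mdist q z).
  move=> Pz pz; apply: (chord2_le hk); [exact: ltW|exact: qx|].
  by have := mdist_lt2 pq pz; lra.
have qa := q2 a Pa pas'; have qb := q2 b Pb pbs'.
apply: (median_drop hk _ _ D0 (hD w wws) (mdist_ge0 q m) t0); try lra.
by rewrite dist_sym mq.
Qed.

(** Compare the two bounds on |xm|, for m the midpoint of two foot points of x:
    an upper one from curvature <= k', a lower one from
    [fiber_almost_convex]. *)
Lemma unique_foot_point : exists2 d : R, 0 < d & forall x, mdist p x < d ->
  exists! q, foot_point (P @^-1` [set P p]) x q.
Proof.
have [C [eta [C0 eta0 etas hC]]] := fiber_almost_convex.
have s0' := s0.
pose B := 1 + `|k'|.
have B0 : 0 < B by rewrite ltr_wpDr.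
(* eta controls almost convexity, 1 / (64 C) the gap between the two bounds
   for the median, and d2 the effect of the curvature k' on the median. *)
pose d1 := Num.min (eta / 2) (64 * C)^-1; pose d2 := Num.min (1 / 4) (8 * B)^-1.
pose d := Num.min d1 d2.
have d10 : 0 < d1 by rewrite lt_min !(divr_gt0, invr_gt0, mulr_gt0).
have d20 : 0 < d2 by rewrite lt_min !(divr_gt0, invr_gt0, mulr_gt0).
have d0 : 0 < d by rewrite lt_min d10.
have d_eta : d <= eta / 2 by rewrite !ge_min lexx.
have d_C : d * (64 * C) <= 1.
  by rewrite -ler_pdivlMr ?mulr_gt0// mul1r !ge_min lexx orbT.
have d_4 : d <= 1 / 4 by rewrite !ge_min lexx !orbT.
have d_B : d * (8 * B) <= 1.
  by rewrite -ler_pdivlMr ?mulr_gt0// mul1r !ge_min lexx !orbT.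
exists d => // x px.
have [|q Pq xq] := @local_lift x (P p).
  have := submetry_lipschitz hP x p; rewrite (dist_sym x p); lra.
have foot_q : foot_point (P @^-1` [set P p]) x q.
  split => // v Pv; rewrite xq -[P p]Pv; exact: submetry_lipschitz.
exists q; split => // q' foot_q'; apply: contrapT => qq'.
have [_ hq] := foot_q; have [Pq' hq'] := foot_q'.
have xq' : mdist x q' = mdist x q by apply/le_anti; rewrite hq'//= hq.
have xp : mdist x q <= mdist p x by rewrite (dist_sym p); exact: hq.
set sg := mdist x q in xq xq' xp.
have pq := dist_triangle p x q; rewrite -/sg in pq.
have pq' := dist_triangle p x q'; rewrite xq' in pq'.
have pxs : mdist p x < s by lra.
have pqs : mdist p q < s by lra.
have pqs' : mdist p q' < s by lra.
have [f gf] := local_geodesic hdist cK near_p pqs pqs'.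
have half01 : 0 <= (1 / 2 : R) <= 1 by lra.
have qq0 : 0 < mdist q q' by rewrite mdist_gt0; apply/eqP.
have tri := dist_triangle q x q'; rewrite xq' (dist_sym q x) -/sg in tri.
have sg0 : 0 < sg by lra.
have [y [_ ey hy]] := upper_hinge hdist s0 cK near_p hk' Ule pxs pqs pqs' gf sg0 qq0.
have := hy (1 / 2) half01; set m := f (1 / 2) => {}hy.
set l := 1 / 2 * mdist q q' in hy.
have lE : mdist q q' = 2 * l by rewrite /l; field.
have l0 : 0 < l by rewrite /l; lra.
rewrite xq' -/sg lE in ey.
have tm : mdist (P m) (P p) <= C * (2 * l) ^+ 2.
  by rewrite -lE; apply: hC => //; lra.
have qm : mdist q m = l by rewrite (geodesic_left gf).
have tq : mdist (P m) (P p) <= l.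
  by rewrite -Pq -qm (dist_sym q); exact: submetry_lipschitz.
have pm := dist_triangle p q m; rewrite qm in pm.
have [|m' Pm' mm'] := @local_lift m (P p); first by lra.
have xm : sg <= mdist x m + C * (2 * l) ^+ 2.
  have := hq m' Pm'; rewrite -/sg; have := dist_triangle x m m'.
  by rewrite mm'; lra.
have xm2 := dist_triangle x q m; rewrite qm -/sg in xm2.
have cl : 0 <= cs k' l by apply: (cs_ge0 hk'); lra.
have := median_le cl ey hy; rewrite -/sg.
have -> : (chord2 k' sg + chord2 k' sg) / 2 = chord2 k' sg by field.
have h0 : 0 <= mdist x m := mdist_ge0 _ _.
apply: (median_gap hk' _ _ sg0 h0 l0 _ C0 _ _ xm); try lra.
  by apply: lt_le_trans d_C; rewrite ltr_pM2r ?mulr_gt0//; lra.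
have h2 : mdist x m ^+ 2 <= (2 * d) ^+ 2.
  by apply: lerXn2r; rewrite ?nnegrE//; lra.
have e2 : `|k'| * (mdist x m) ^+ 2 <= `|k'| * (2 * d) ^+ 2 by exact: ler_wpM2l.
have dd : d * (8 * B) * d <= 1 * (1 / 4).
  by apply: ler_pM => //; [rewrite !mulr_ge0// ltW|exact: ltW].
by have := sqr_ge0 d; rewrite /B in dd; lra.
Qed.

End LocalFiber.

(** * Positive reach *)

Theorem theorem1p1 (R : realType) (n : nat) (M : metricType R)
    (S : riemannian_structure R n M)
    (hdist : is_riemannian_distance S)
    (hcurv : local_two_sided_curvature_bounds M)
    (Y : metricType R) (P : M -> Y) (hP : submetry P) (y : Y) :
  positive_reach (P @^-1` [set y]).
Proof.
have local p : P p = y -> exists2 d : R, 0 < d &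
    forall x, mdist p x < d -> exists! q, foot_point (P @^-1` [set y]) x q.
  move=> <-; have [U [k [k' [oU Up Uge Ule]]]] := hcurv p.
  have : nbhs p U by apply: open_nbhs_nbhs.
  move=> /nbhs_ballP[e /= e0 eU].
  have [phi [K [r [C [r0 _ cK hK _]]]]] := local_chart hdist p.
  have [rk hrk] := model_radius_exists k.
  have [rk' hrk'] := model_radius_exists k'.
  have rk0 : 0 < rk by have [] := hrk.
  have rk'0 : 0 < rk' by have [] := hrk'.
  pose s := Num.min (Num.min e r) (Num.min rk rk') / 8.
  have s0 : 0 < s by rewrite divr_gt0// !lt_min e0 r0 rk0.
  have [s1 s2 s3 s4] : [/\ 8 * s <= e, 8 * s <= r, 8 * s <= rk & 8 * s <= rk'].
    have -> : 8 * s = Num.min (Num.min e r) (Num.min rk rk') by rewrite /s; field.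
    by rewrite !ge_min !lexx !orbT.
  have s80 : 0 < 8 * s by rewrite mulr_gt0.
  apply: (unique_foot_point hdist s0 cK _ (model_radiusW hrk s80 s3)
    (model_radiusW hrk' s80 s4) Uge Ule hP).
  move=> z pz; split; first by have [] := hK z (ltac:(lra)).
  by apply: eU; rewrite ballEmdist/=; lra.
exists [set x | exists p d, [/\ P p = y, mdist p x < d &
  forall x', mdist p x' < d -> exists! q, foot_point (P @^-1` [set y]) x' q]].
split.
- rewrite openE => x [p [d [Pp px hd]]].
  have e0 : 0 < d - mdist p x by rewrite subr_gt0.
  apply/nbhs_ballP; exists (d - mdist p x) => //= x'.
  rewrite ballEmdist/= => xx'; exists p, d; split => //.
  by have := dist_triangle p x x'; lra.
- move=> p Pp; have [d d0 hd] := local p Pp.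
  by exists p, d; split => //; rewrite mdistxx.
- by move=> x [p [d [_ px hd]]]; exact: hd.
Qed.
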